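(* Let $d\ge1$, let $k(x,y)=e^{-\sigma\|x-y\|_2^2}$ be the Gaussian kernel on $[0,1]^d$ with $\sigma>0$, and let $P$ be a probability measure on $[0,1]^d$ with density $p$ satisfying $0<\inf p\le\sup p<\infty$. Let $\varphi_1,\varphi_2,\dots$ be the eigenfunctions in the Mercer decomposition of $k$. Then there exists a constant $b>0$ such that $$\max_{x\in[0,1]^d}|\varphi_\ell(x)|\le b\,\ell^2,\qquad\ell=1,2,\dots.$$
   Context: The $\varphi_\ell$ are the continuous, $L^2([0,1]^d,P)$-orthonormal eigenfunctions, with eigenvalues $\mu_\ell$ in non-increasing order (with multiplicity), of the operator $(L_kf)(y)=\int_{[0,1]^d}k(z,y)f(z)p(z)\,dz$ on $L^2([0,1]^d,P)$, so that $k(x,y)=\sum_{\ell\ge1}\mu_\ell\varphi_\ell(x)\varphi_\ell(y)$. *)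

(* Defs.v *)
From HB Require Import structures.
From mathcomp Require Import all_boot all_order all_algebra.
From mathcomp Require Import all_classical all_reals all_analysis.

Set Implicit Arguments.
Unset Strict Implicit.
Unset Printing Implicit Defensive.
Import Order.TTheory GRing.Theory Num.Theory.
Import numFieldNormedType.Exports.
Local Open Scope classical_set_scope.
Local Open Scope ring_scope.

(* Row vectors carry the sigma-algebra generated by the coordinates; over the
   reals it is the Borel sigma-algebra of the library's topology on them. *)
Section measurable_rV.
Context {disp : measure_display} {T : measurableType disp}.
Variable n : nat.

Let coord : 'I_n -> 'rV[T]_n -> T := fun i v => v ord0 i.

Let rV_set0 : g_sigma_preimage coord set0.
Proof. exact: sigma_algebra0. Qed.

Let rV_setC A : g_sigma_preimage coord A -> g_sigma_preimage coord (~` A).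
Proof. exact: sigma_algebraC. Qed.

Let rV_bigcup (F : _^nat) : (forall i, g_sigma_preimage coord (F i)) ->
  g_sigma_preimage coord (\bigcup_i (F i)).
Proof. exact: sigma_algebra_bigcup. Qed.

HB.instance Definition _ := @isMeasurable.Build (measure_tuple_display disp)
  'rV[T]_n (g_sigma_preimage coord) rV_set0 rV_setC rV_bigcup.

Lemma measurable_coord (i : 'I_n) :
  measurable_fun [set: 'rV[T]_n] (fun v : 'rV[T]_n => v ord0 i).
Proof.
move=> _ Y mY; rewrite setTI; apply: sub_sigma_algebra => /=.
rewrite -bigcup_seq/=; exists i => /=; first by rewrite mem_index_enum.
by exists Y => //; rewrite setTI.
Qed.

Lemma measurable_fun_rVP d1 (T1 : measurableType d1) (f : T1 -> 'rV[T]_n) :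
  (forall i, measurable_fun [set: T1] (fun x => f x ord0 i)) ->
  measurable_fun [set: T1] f.
Proof.
move=> mf.
have: g_sigma_preimage (fun i => coord i \o f) `<=` measurable.
  apply: smallest_sub; first exact: sigma_algebra_measurable.
  move=> A; rewrite -bigcup_seq/= => -[i _ [B mB <-]].
  exact: mf.
by rewrite g_sigma_preimage_comp => prefS _ A mA; apply: prefS; exists A.
Qed.

End measurable_rV.

Section lebesgue_rV.
Context {R : realType}.
Local Open Scope ereal_scope.

Definition cons_rV n (xv : measurableTypeR R * 'rV[R]_n) : 'rV[R]_n.+1 :=
  \row_i (if unlift ord0 i is Some j then xv.2 ord0 j else xv.1).

Lemma cons_rV0 n xv : @cons_rV n xv ord0 ord0 = xv.1.
Proof. by rewrite mxE unlift_none. Qed.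

Lemma cons_rVS n xv (i : 'I_n) : @cons_rV n xv ord0 (lift ord0 i) = xv.2 ord0 i.
Proof. by rewrite mxE liftK. Qed.

Lemma measurable_cons_rV n : measurable_fun [set: _] (@cons_rV n).
Proof.
apply: measurable_fun_rVP => i.
case: (unliftP ord0 i) => [j ->|->].
- under eq_fun do rewrite cons_rVS.
  exact: (measurableT_comp (measurable_coord j)).
- under eq_fun do rewrite cons_rV0.
  exact: (@measurable_fst _ _ (measurableTypeR R) 'rV[R]_n).
Qed.

Definition uncons_rV n (v : 'rV[R]_n.+1) : measurableTypeR R * 'rV[R]_n :=
  (v ord0 ord0, \row_i v ord0 (lift ord0 i)).

Lemma cons_rVK n : cancel (@cons_rV n) (@uncons_rV n).
Proof.
move=> [x v]; rewrite /uncons_rV cons_rV0; congr pair.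
by apply/rowP => i; rewrite mxE cons_rVS.
Qed.

Lemma measurable_uncons_rV n : measurable_fun [set: _] (@uncons_rV n).
Proof.
apply/measurable_fun_pairP; split => /=.
  exact: measurable_coord.
apply: measurable_fun_rVP => i.
under eq_fun do rewrite /uncons_rV /= mxE.
exact: measurable_coord.
Qed.

Section step.
Variables (n : nat) (mu : {sigma_finite_measure set 'rV[R]_n -> \bar R}).

Definition lebesgue_rV_step : set 'rV[R]_n.+1 -> \bar R :=
  pushforward (lebesgue_measure \x mu) (@cons_rV n).

Let step0 : lebesgue_rV_step set0 = 0.
Proof. by rewrite /lebesgue_rV_step /pushforward preimage_set0 measure0. Qed.

Let step_ge0 A : 0 <= lebesgue_rV_step A.
Proof. exact: (measure_ge0 (lebesgue_measure \x mu)). Qed.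

Let step_sigma_additive : semi_sigma_additive lebesgue_rV_step.
Proof.
move=> F mF tF mUF; rewrite /lebesgue_rV_step /pushforward preimage_bigcup.
have mpre A : measurable A -> measurable (@cons_rV n @^-1` A).
  by move=> mA; rewrite -[X in measurable X]setTI; exact: measurable_cons_rV.
apply: (@measure_semi_sigma_additive _ _ _ (lebesgue_measure \x mu)).
- by move=> k; exact: mpre.
- apply/trivIsetP => /= i j _ _ ij; rewrite -preimage_setI.
  by move/trivIsetP : tF => /(_ _ _ _ _ ij) ->//; rewrite preimage_set0.
- by rewrite -preimage_bigcup; exact: mpre.
Qed.

HB.instance Definition _ := isMeasure.Build _ _ _ lebesgue_rV_step
  step0 step_ge0 step_sigma_additive.

Let step_sigma_finite : sigma_finite setT lebesgue_rV_step.
Proof.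
have /sigma_finiteP[F [TF ndF Foo]] :=
  sigma_finiteT (@lebesgue_measure R : {sigma_finite_measure set _ -> \bar R}).
have /sigma_finiteP[G [TG ndG Goo]] := sigma_finiteT mu.
exists (fun i => @uncons_rV n @^-1` (F i `*` G i)).
  rewrite -preimage_bigcup (_ : \bigcup_i _ = setT) ?preimage_setT//.
  rewrite -subTset => -[x v] _.
  have [i _ Fix] : (\bigcup_i F i) x by rewrite -TF.
  have [j _ Gjv] : (\bigcup_j G j) v by rewrite -TG.
  exists (maxn i j) => //; split => /=.
    by move: x Fix; exact/subsetPset/ndF/leq_maxl.
  by move: v Gjv; exact/subsetPset/ndG/leq_maxr.
move=> i; have [mF Fioo] := Foo i; have [mG Gioo] := Goo i; split.
  rewrite -[X in measurable X]setTI; apply: measurable_uncons_rV => //.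
  exact: measurableX.
rewrite /lebesgue_rV_step /pushforward -comp_preimage.
rewrite (_ : _ \o _ = id) ?preimage_id; last first.
  by apply/funext => x; exact: cons_rVK.
by rewrite product_measure1E// lte_mul_pinfty// ge0_fin_numE.
Qed.

HB.instance Definition _ := Measure_isSigmaFinite.Build _ _ _ lebesgue_rV_step
  step_sigma_finite.

End step.

(* Lebesgue measure on R^n: the image under (x, v) |-> cons x v of the product
   of one-dimensional Lebesgue measure with Lebesgue measure on R^(n-1); on R^0
   it is the Dirac mass at the only point. *)
Fixpoint lebesgue_rV n : {sigma_finite_measure set 'rV[R]_n -> \bar R} :=
  if n is n'.+1 then lebesgue_rV_step (lebesgue_rV n')
  else dirac (0%R : 'rV[R]_0).

End lebesgue_rV.

Section mercer.
Context {R : realType} (d : nat).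

Definition unit_cube : set 'rV[R]_d :=
  [set x | forall i : 'I_d, 0 <= x ord0 i <= 1].

(* `|_| on row vectors is the sup norm, hence the explicit Euclidean one. *)
Definition gaussian_kernel (sigma : R) (x y : 'rV[R]_d) : R :=
  expR (- sigma * \sum_(i < d) (x ord0 i - y ord0 i) ^+ 2).

(* P is carried by the cube, with density p there; the values of p outside the
   cube are irrelevant. *)
Definition has_cube_density (P : probability 'rV[R]_d R) (p : 'rV[R]_d -> R) :=
  measurable_fun unit_cube p /\
  forall A, measurable A ->
    P A = (\int[lebesgue_rV d]_(x in A `&` unit_cube) (p x)%:E)%E.

Definition integral_operator (k : 'rV[R]_d -> 'rV[R]_d -> R)
    (p f : 'rV[R]_d -> R) (y : 'rV[R]_d) : R :=
  \int[lebesgue_rV d]_(z in unit_cube) (k z y * f z * p z).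

(* Eigenpairs are numbered from 1: mu 0 and phi 0 are unconstrained, and so are
   the values of phi l outside the cube. The pointwise expansion of k is what
   makes the list complete, i.e. every nonzero eigenvalue occurs in mu as many
   times as its multiplicity. *)
Record mercer_decomposition (k : 'rV[R]_d -> 'rV[R]_d -> R)
    (P : probability 'rV[R]_d R) (p : 'rV[R]_d -> R)
    (mu : nat -> R) (phi : nat -> 'rV[R]_d -> R) : Prop := MercerDecomposition {
  mercer_continuous : forall l, (1 <= l)%N ->
    {within unit_cube, continuous (phi l)} ;
  mercer_orthonormal : forall l m, (1 <= l)%N -> (1 <= m)%N ->
    \int[P]_(x in unit_cube) (phi l x * phi m x) = (l == m)%:R ;
  mercer_eigen : forall l, (1 <= l)%N -> forall y, unit_cube y ->
    integral_operator k p (phi l) y = mu l * phi l y ;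
  mercer_nonincreasing : forall l, (1 <= l)%N -> mu l.+1 <= mu l ;
  mercer_expansion : forall x y, unit_cube x -> unit_cube y ->
    \sum_(1 <= l < n) mu l * phi l x * phi l y @[n --> \oo] --> k x y
}.

End mercer.
Arguments unit_cube {R} d.

(* Main.v *)
From HB Require Import structures.
Require Import Defs.
From mathcomp Require Import all_boot all_order all_algebra.
From mathcomp Require Import all_classical all_reals all_analysis.
From mathcomp Require Import measurable_realfun polyrcf zify ring lra.
Import Order.TTheory GRing.Theory Num.Theory.
Import numFieldNormedType.Exports.
Local Open Scope classical_set_scope.
Local Open Scope ring_scope.

(* Write [k x y = w x * w y * exp (2 sigma <x, y>)] with [w x = exp (- sigma |x|^2)].
   Truncating the exponential series after [M] terms in [mu_l phi_l = L_k phi_l]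
   shows that [phi_l] is within [C^M / (M! mu_l)] of [w q], where [q] has degree
   less than [M] in each variable, and [|q x|^2 <= (2 M^2)^d * int q^2] on the
   cube.  Conversely, if [l <= n^d], some nonzero [f] in the span of the
   [w x^b], [b < n] coordinatewise, is orthogonal to [phi_1, ..., phi_(l-1)], so
   that [<L_k f, f> <= mu_l |f|^2]; the Taylor coefficients of [k] and a bound for
   the coefficients of a polynomial by its mean square then give
   [1 / mu_l <= (C n)^(C n)].  Hence the error is at most 1 for [M = 2 n^2] and
   large [n], and [M^d] is of order [n^(2d)], that is, [l^2]. *)

Set Implicit Arguments.
Unset Strict Implicit.
Unset Printing Implicit Defensive.

(** * The inverse of the Hilbert matrix *)

(** Estimating [L_k phi_l / mu_l] directly loses a factor [1 / mu_l]; truncation moves this loss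
    into the degree [M], because the error decays factorially. The two polynomial inequalities bear
    very different constants. The coefficient bound enters only through [1 / mu_l], so [(2 n)^(2 n)]
    per variable is harmless: [M!] absorbs it. The bound on values enters the result itself and must
    be a power of [M]. Both are Cauchy-Schwarz against the polynomial that represents the functional
    in the mean square inner product. Its coefficients come from the explicit inverse of the Hilbert
    matrix, and representing polynomials multiply across variables, so one variable is enough up to
    a [d]-th power. With [M] quadratic in [n], [M!] outgrows every [n^(C n)] without any tracking of
    [C]; this choice is the source of the exponent 2 in [l^2]. The lower bound of [p] turns mean
    squares under [P] into bounds on mean squares under Lebesgue measure. *)

Section hilbert.
Variables (R : realFieldType) (n : nat).

Lemma prod_sub_ord_neq0 (i : 'I_n) :
  \prod_(k < n | k != i) (k%:R - i%:R : R) != 0.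
Proof. by apply/prodf_neq0 => k ki; rewrite subr_eq0 eqr_nat. Qed.

(** Lagrange interpolation of [A] at the nodes [-1, ..., -n], evaluated at [a] and divided by the
    product of the [a + k + 1]: the partial fraction expansion of a rational function with simple
    poles at these nodes. *)
Lemma partial_fractions (A : {poly R}) (a : nat) : (size A <= n)%N ->
  \sum_(i < n) A.[- i.+1%:R] / \prod_(k < n | k != i) (k%:R - i%:R) / (i + a).+1%:R
  = A.[a%:R] / \prod_(k < n) (a + k).+1%:R.
Proof.
case: n => [|m] sA.
  by move: sA; rewrite leqn0 size_poly_eq0 => /eqP->; rewrite !big_ord0 horner0 mul0r.
pose x i : R := - i.+1%:R.
have xinj : injective x by move=> i j /oppr_inj/eqP; rewrite eqr_nat => /eqP[].
have D0 (Q : pred 'I_m.+1) : \prod_(k < m.+1 | Q k) (a + k).+1%:R != 0 :> R.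
  by apply/prodf_neq0 => k _; rewrite pnatr_eq0.
rewrite [A in RHS](lagrange_gen (ltn0Sn m) xinj sA) horner_sum mulr_suml.
apply: eq_bigr => i _; rewrite hornerM hornerC lagrangeE //= hornerM hornerC !horner_prod.
rewrite -!mulrA; congr (_ * _).
have -> : \prod_(k < m.+1 | k != i) (k%:R - i%:R) =
    \prod_(j < m.+1 | j != i) ('X - (x j)%:P).[x i] :> R.
  by apply: eq_bigr => k _; rewrite hornerXsubC /x -!natr1; ring.
congr (_ * _).
have -> : \prod_(j < m.+1 | j != i) ('X - (x j)%:P).[a%:R] =
    \prod_(j < m.+1 | j != i) (a + j).+1%:R.
  by apply: eq_bigr => k _; rewrite hornerXsubC /x -!natr1 natrD; ring.
rewrite [\prod_(k < m.+1) _](bigD1 i) //= invfM mulrCA divff ?mulr1 ?D0//.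
by rewrite addnC.
Qed.

(* Residues of the rational function with poles at [-1, ..., -n], zeros at the
   [k < n] other than [j], and value 1 at [j]. *)
Definition hilbert_inv (j i : 'I_n) : R :=
  \prod_(k < n) (j + k).+1%:R / \prod_(k < n | k != j) (k%:R - j%:R) *
  \prod_(k < n | k != j) (k + i).+1%:R / \prod_(k < n | k != i) (k%:R - i%:R).

(** [A], the numerator of the function described above, has degree [n - 1], so [partial_fractions]
    applies; reading the expansion at the integers [a < n] shows that its residues form row [j] of
    the inverse matrix. *)
Lemma hilbert_invE (j a : 'I_n) :
  \sum_(i < n) hilbert_inv j i / (i + a).+1%:R = (a == j)%:R.
Proof.
pose c : R := \prod_(k < n) (j + k).+1%:R / \prod_(k < n | k != j) (k%:R - j%:R).
pose A : {poly R} := c *: \prod_(k < n | k != j) (k%:R%:P - 'X).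
have sA : (size A <= n)%N.
  rewrite (leq_trans (size_scale_leq _ _))// (leq_trans (size_poly_prod_leq _ _))//.
  rewrite (eq_bigr (fun=> 2)) => [|k _]; last first.
    by rewrite -opprB size_polyN size_XsubC.
  rewrite sum_nat_const cardC1 card_ord; case: n j {c A} => [[]//|m _] /=.
  lia.
have := partial_fractions a sA; rewrite /A hornerZ horner_prod => E.
transitivity (\sum_(i < n) A.[- i.+1%:R] / \prod_(k < n | k != i) (k%:R - i%:R) /
  (i + a).+1%:R).
  apply: eq_bigr => i _; rewrite /A hornerZ horner_prod /hilbert_inv -/c.
  do 3 congr (_ * _); apply: eq_bigr => k _.
  by rewrite hornerD hornerN hornerX hornerC opprK -natrD addnS.
rewrite E; have [->|aj] := eqVneq a j.
  have -> : \prod_(k < n | k != j) (k%:R%:P - 'X).[j%:R] =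
      \prod_(k < n | k != j) (k%:R - j%:R) :> R.
    by apply: eq_bigr => k _; rewrite hornerD hornerN hornerX hornerC.
  rewrite /c mulfVK ?prod_sub_ord_neq0// divff//.
  by apply/prodf_neq0 => k _; rewrite pnatr_eq0.
by rewrite (bigD1 a)//= hornerD hornerN hornerX hornerC subrr mul0r mulr0 mul0r.
Qed.

(** On the diagonal the denominator is the square of a nonzero integer, hence at least 1, and each
    of the two numerators has at most [n] factors, all below [2 n]. *)
Lemma hilbert_inv_diag_le (j : 'I_n) : hilbert_inv j j <= (2 * n)%:R ^+ (2 * n).
Proof.
have n0 : (0 < n)%N by case: n j => [[]|].
rewrite /hilbert_inv -mulrA mulrACA -invfM -expr2.
set D := \prod_(k < n | _) (_ - _).
have P0 (Q : pred 'I_n) : 0 <= \prod_(k < n | Q k) (k + j).+1%:R :> R.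
  by apply: prodr_ge0 => k _.
have le1 (Q : pred 'I_n) : \prod_(k < n | Q k) (k + j).+1%:R <= (2 * n)%:R ^+ n :> R.
  apply: (@le_trans _ _ (\prod_(k < n | Q k) (2 * n)%:R)).
    apply: ler_prod => k _; rewrite ler0n ler_nat.
    by have := ltn_ord k; have := ltn_ord j; lia.
  rewrite prodr_const -[X in _ <= _ ^+ X](card_ord n); apply: ler_weXn2l.
    by rewrite ler1n; lia.
  exact: max_card.
have D1 : 1 <= D ^+ 2.
  rewrite -real_normK ?num_real// expr_ge1// normr_prod.
  elim/big_ind: _ => [//|x y|k kj]; first exact: mulr_ege1.
  have /lt_total/orP[kj'|kj'] : (k : nat) != j by [].
    rewrite distrC ger0_norm ?subr_ge0 ?ler_nat ?(ltnW kj')//.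
    by rewrite -natrB ?(ltnW kj')// ler1n subn_gt0.
  rewrite ger0_norm ?subr_ge0 ?ler_nat ?(ltnW kj')//.
  by rewrite -natrB ?(ltnW kj')// ler1n subn_gt0.
rewrite ler_pdivrMr ?(lt_le_trans ltr01)//.
apply: (@le_trans _ _ ((2 * n)%:R ^+ (2 * n))); last by rewrite ler_peMr// exprn_ge0.
have -> : \prod_(k < n) (j + k).+1%:R = \prod_(k < n) (k + j).+1%:R :> R.
  by apply: eq_bigr => k _; rewrite addnC.
by rewrite [in X in _ <= _ ^+ X]mul2n -addnn exprD ler_pM.
Qed.
End hilbert.

(** The exact value matters here: it is the squared norm of the polynomial representing evaluation
    at 0, and being polynomial in the degree it keeps the later bound on values polynomial. *)
Lemma hilbert_inv_00 (R : realFieldType) m :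
  hilbert_inv R (ord0 : 'I_m.+1) ord0 = m.+1%:R ^+ 2.
Proof.
have F p : \prod_(k < p) k.+1%:R = p`!%:R :> R.
  by elim: p => [|p IH]; rewrite ?big_ord0// big_ord_recr/= IH factS natrM mulrC.
have G (f : 'I_m.+1 -> R) : \prod_(k < m.+1 | k != ord0) f k = \prod_(k < m) f (lift ord0 k).
  by rewrite big_mkcond big_ord_recl/= mul1r.
rewrite /hilbert_inv !G/=.
have -> : \prod_(k < m) ((bump 0 k)%:R - 0) = m`!%:R :> R.
  by rewrite -F; apply: eq_bigr => k _; rewrite subr0.
have -> : \prod_(k < m) (bump 0 k + 0).+1%:R = m.+1`!%:R :> R.
  rewrite -F big_ord_recl mul1r; apply: eq_bigr => k _; by rewrite addn0.
have -> : \prod_(k < m.+1) (0 + k).+1%:R = m.+1`!%:R :> R by rewrite -F.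
have m0 : m`!%:R != 0 :> R by rewrite pnatr_eq0 -lt0n fact_gt0.
by rewrite factS natrM mulfK// mulrA mulfK// expr2.
Qed.

(** * Polynomial inequalities in the mean square norm on [0, 1] *)

Section poly_integral.
Variable R : rcfType.
Implicit Types p q : {poly R}.

(** At [i = 0] the quotient is a division by 0, hence 0: this is the primitive that vanishes at
    0. *)
Definition primitive_poly p := \poly_(i < (size p).+1) (p`_i.-1 / i%:R).

Lemma coef_primitive_poly p i : (primitive_poly p)`_i = p`_i.-1 / i%:R.
Proof.
rewrite coef_poly; case: ifPn => //; rewrite -leqNgt => h.
rewrite nth_default ?mul0r//; by case: i h.
Qed.

Lemma deriv_primitive_poly p : (primitive_poly p)^`() = p.
Proof.
apply/polyP => i; rewrite coef_deriv coef_primitive_poly/= -[LHS]mulr_natr.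
by rewrite mulfVK// pnatr_eq0.
Qed.

Definition int01 p := (primitive_poly p).[1].

Lemma int01_is_linear : scalar int01.
Proof.
move=> a p q; rewrite /int01 -hornerZ -hornerD; congr (_.[1]).
apply/polyP => i; rewrite coefD coefZ !coef_primitive_poly coefD coefZ; ring.
Qed.
HB.instance Definition _ := GRing.isLinear.Build R {poly R} R *%R int01 int01_is_linear.

Lemma int01Z a p : int01 (a *: p) = a * int01 p.
Proof. exact: linearZ. Qed.

Lemma int01_deriv p : int01 p^`() = p.[1] - p.[0].
Proof.
rewrite /int01; pose D := primitive_poly p^`() - p + p.[0]%:P.
suff : D = 0 by move=> /(congr1 (fun q => q.[1])); rewrite !hornerE; lra.
apply/polyP => -[|i]; rewrite coefD coefB coefC coef0 coef_primitive_poly/=.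
  by rewrite invr0 mulr0 horner_coef0; lra.
rewrite coef_deriv -[_ *+ i.+1]mulr_natr mulfK ?pnatr_eq0//; lra.
Qed.

Lemma int01X i : int01 'X^i = i.+1%:R^-1.
Proof.
have -> : 'X^i = ((i.+1%:R : R)^-1 *: 'X^(i.+1))^`() :> {poly R}.
  by rewrite derivZ derivXn -[X in _ = _ *: X]scaler_nat scalerA mulVf ?scale1r// pnatr_eq0.
by rewrite int01_deriv !hornerZ !hornerXn expr1n expr0n mulr1 mulr0 subr0.
Qed.

Lemma ler_primitive_sqr q (x y : R) : x <= y ->
  (primitive_poly (q ^+ 2)).[x] <= (primitive_poly (q ^+ 2)).[y].
Proof.
move=> xy; apply: (@ler_hornerW _ x y) => //; rewrite ?in_itv/= ?lexx ?xy//.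
by move=> z _; rewrite deriv_primitive_poly horner_exp sqr_ge0.
Qed.
End poly_integral.

Section int01_bounds.
Variable R : rcfType.
Implicit Types p q : {poly R}.

Lemma int01_sqr_ge0 q : 0 <= int01 (q ^+ 2).
Proof.
have := ler_primitive_sqr q (@ler01 R).
by rewrite {1}horner_coef0 coef_primitive_poly/= invr0 mulr0.
Qed.

Lemma int01_mulE n (q r : {poly R}) : (size q <= n)%N -> (size r <= n)%N ->
  int01 (q * r) = \sum_(i < n) \sum_(j < n) q`_i * r`_j / (i + j).+1%:R.
Proof.
move=> sq sr; have E p : (size p <= n)%N -> p = \sum_(i < n) p`_i *: 'X^i.
  move=> sp; rewrite -poly_def; apply/polyP => i; rewrite coef_poly.
  by case: ltnP => // h; rewrite nth_default// (leq_trans sp).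
rewrite {1}(E _ sq) mulr_suml linear_sum; apply: eq_bigr => i _.
rewrite {1}(E _ sr) mulr_sumr linear_sum; apply: eq_bigr => j _ /=.
by rewrite -scalerAl -scalerAr -exprD !int01Z int01X mulrA.
Qed.

(** The Gram matrix of the monomials on [0, 1] is the Hilbert matrix, so row [j] of its inverse
    gives the polynomial representing the functional that sends [q] to its coefficient of index [j].
    The default of [insub] is never reached, since [i < n]. *)
Definition hilbert_poly n (j : 'I_n) : {poly R} :=
  \poly_(i < n) (if insub i is Some i' then hilbert_inv R j i' else 0).

Lemma size_hilbert_poly n (j : 'I_n) : (size (hilbert_poly j) <= n)%N.
Proof. exact: size_poly. Qed.

Lemma coef_hilbert_poly n (j i : 'I_n) : (hilbert_poly j)`_i = hilbert_inv R j i.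
Proof. by rewrite coef_poly ltn_ord valK. Qed.

Lemma int01_hilbert_poly n (j : 'I_n) q : (size q <= n)%N ->
  int01 (hilbert_poly j * q) = q`_j.
Proof.
move=> sq; rewrite (int01_mulE (size_hilbert_poly _) sq) exchange_big/= (bigD1 j)//=.
have E (b : 'I_n) :
    \sum_(i < n) (hilbert_poly j)`_i * q`_b / (i + b).+1%:R = (b == j)%:R * q`_b.
  rewrite -hilbert_invE mulr_suml; apply: eq_bigr => i _.
  by rewrite coef_hilbert_poly mulrAC.
by rewrite E eqxx mul1r big1 ?addr0// => b /negPf bj; rewrite E bj mul0r.
Qed.

(** Cauchy-Schwarz against [K], whose squared norm is [N = n^2], in the form of a single square: the
    integral of [(N q - q_0 K)^2] equals [N (N int q^2 - q_0^2)]. *)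
Lemma int01_sqr_ge_coef0 n q : (size q <= n)%N ->
  q`_0 ^+ 2 <= n%:R ^+ 2 * int01 (q ^+ 2).
Proof.
case: n => [|n] sq.
  by move: sq; rewrite leqn0 size_poly_eq0 => /eqP->; rewrite coef0 expr2 !mul0r.
pose K := hilbert_poly (ord0 : 'I_n.+1).
have Kq : int01 (K * q) = q`_0 by rewrite (int01_hilbert_poly ord0).
have KK : int01 (K * K) = n.+1%:R ^+ 2.
  by rewrite (int01_hilbert_poly ord0) ?size_hilbert_poly// coef_hilbert_poly hilbert_inv_00.
have N0 : 0 < (n.+1%:R : R) ^+ 2 by rewrite exprn_gt0.
have := int01_sqr_ge0 (n.+1%:R ^+ 2 *: q - q`_0 *: K).
have -> : (n.+1%:R ^+ 2 *: q - q`_0 *: K) ^+ 2 =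
  (n.+1%:R ^+ 2) ^+ 2 *: q ^+ 2 - (2 * n.+1%:R ^+ 2 * q`_0) *: (K * q) + q`_0 ^+ 2 *: (K * K).
  rewrite -!mul_polyC !polyCM; ring.
rewrite raddfD raddfB/= !int01Z Kq KK => h.
nra.
Qed.

(* Mapping [0, 1] affinely onto the segment from [x] to [y] reduces this to the
   inequality at 0; [y] will be the end point farther from [x]. *)
Lemma int01_sqr_ge_corner n q x y : (size q <= n)%N -> 0 <= x <= 1 -> 0 <= y <= 1 ->
  `|y - x| * q.[x] ^+ 2 <= n%:R ^+ 2 * int01 (q ^+ 2).
Proof.
move=> sq /andP[x0 x1] /andP[y0 y1].
pose L : {poly R} := x%:P + (y - x) *: 'X.
have sL : (size (q \Po L) <= n)%N.
  have [->|q0] := eqVneq q 0; first by rewrite comp_poly0 size_poly0.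
  rewrite (leq_trans (size_comp_poly_leq _ _))//.
  have sL : ((size L).-1 <= 1)%N.
    rewrite -subn1 leq_subLR (leq_trans (size_polyD _ _))// geq_max.
    rewrite (leq_trans (size_polyC_leq1 _))//=.
    by rewrite (leq_trans (size_scale_leq _ _))// size_polyX.
  rewrite (leq_trans _ sq)// -[leqRHS]prednK ?size_poly_gt0// ltnS.
  by rewrite -[leqRHS]muln1 leq_mul.
have := int01_sqr_ge_coef0 sL; rewrite -horner_coef0 horner_comp.
have -> : L.[0] = x by rewrite /L !hornerE.
have LE : `|y - x| * int01 ((q \Po L) ^+ 2) <= int01 (q ^+ 2).
  pose Q := primitive_poly (q ^+ 2).
  have E : (y - x) * int01 ((q \Po L) ^+ 2) = Q.[y] - Q.[x].
    have -> : (y - x) * int01 ((q \Po L) ^+ 2) = int01 (Q \Po L)^`().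
      rewrite deriv_comp deriv_primitive_poly -int01Z rmorphXn/= [L^`()]derivD.
      by rewrite derivC add0r derivZ derivX -[in RHS](mul_polyC (y - x)) mulr1 mulrC mul_polyC.
    rewrite int01_deriv !horner_comp; congr (Q.[_] - Q.[_]);
      rewrite /L hornerD hornerC hornerZ hornerX; ring.
  have Q0 : Q.[0] = 0 by rewrite horner_coef0 coef_primitive_poly/= invr0 mulr0.
  have -> : int01 (q ^+ 2) = Q.[1] by [].
  have [xy|/ltW yx] := lerP x y.
    rewrite E.
    have := ler_primitive_sqr q x0; have := ler_primitive_sqr q y1; rewrite -/Q; lra.
  rewrite -[x - y]opprB mulNr E.
  have := ler_primitive_sqr q y0; have := ler_primitive_sqr q x1; rewrite -/Q; lra.
move=> h; apply: le_trans (ler_wpM2l (sqr_ge0 n%:R) LE).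
by rewrite [leRHS]mulrCA ler_wpM2l.
Qed.

(** The farther end point of [0, 1] is at distance at least 1/2 from [x], whence the factor 2. *)
Lemma int01_sqr_ge_horner n q x : (size q <= n)%N -> 0 <= x <= 1 ->
  q.[x] ^+ 2 <= 2 * n%:R ^+ 2 * int01 (q ^+ 2).
Proof.
move=> sq x01; have /andP[x0 x1] := x01.
have [y y01 yx] : exists2 y, 0 <= y <= 1 & 1 <= 2 * `|y - x|.
  have [xh|xh] := lerP x 2^-1; [exists 1|exists 0]; rewrite ?ler01 ?lexx//.
    by rewrite ger0_norm; lra.
  by rewrite ler0_norm; lra.
have := int01_sqr_ge_corner sq x01 y01.
have := sqr_ge0 q.[x]; nra.
Qed.
End int01_bounds.

(** * Duality bounds for coefficients and values of tensor polynomials *)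

Section duality.
Variable R : rcfType.

Lemma discriminant_le (a b s : R) :
  (forall u v, 0 <= u ^+ 2 * a + 2 * u * v * s + v ^+ 2 * b) -> s ^+ 2 <= a * b.
Proof.
move=> h; have a0 : 0 <= a by have := h 1 0; rewrite expr1n; lra.
have [a00|an0] := eqVneq a 0.
  rewrite a00 mul0r; case: (eqVneq s 0) => [->|s0]; first by rewrite expr0n.
  (* If [a = 0] and [s] is nonzero, this choice of [u] gives the form the value
     [-(b + 1) + b = -1]. *)
  have := h (- (b + 1) / (2 * s)) 1.
  have -> : 2 * (- (b + 1) / (2 * s)) * 1 * s = - (b + 1) by field.
  by rewrite a00; lra.
have := h (- s) a.
have -> : (- s) ^+ 2 * a + 2 * - s * a * s + a ^+ 2 * b = a * (a * b - s ^+ 2) by ring.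
by rewrite pmulr_rge0 ?subr_ge0// lt_def an0 a0.
Qed.

Lemma hilbert_inv_diag_ge0 n (j : 'I_n) : 0 <= hilbert_inv R j j.
Proof.
have := int01_sqr_ge0 (hilbert_poly R j).
by rewrite expr2 int01_hilbert_poly ?size_hilbert_poly// coef_hilbert_poly.
Qed.

(** [kappa] lists the coefficients of the polynomial [q] that represents evaluation at [x]. Its
    squared norm is therefore its own value [v] at [x], and the bound on values reads
    [v^2 <= 2 n^2 v], that is, [v <= 2 n^2]. *)
Lemma evaluation_dual n x : 0 <= x <= 1 -> exists2 kappa : 'I_n -> R,
  forall a : 'I_n, \sum_(i < n) kappa i / (i + a).+1%:R = x ^+ a &
  0 <= \sum_(a < n) kappa a * x ^+ a <= 2 * n%:R ^+ 2.
Proof.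
move=> x01; pose kappa i := \sum_(j < n) x ^+ j * hilbert_inv R j i.
have kE (a : 'I_n) : \sum_(i < n) kappa i / (i + a).+1%:R = x ^+ a.
  under eq_bigr do rewrite mulr_suml.
  rewrite exchange_big (bigD1 a)//= [X in _ + X]big1 => [|j ja]; last first.
    under eq_bigr do rewrite -mulrA.
    by rewrite -mulr_sumr hilbert_invE eq_sym (negPf ja) mulr0.
  under eq_bigr do rewrite -mulrA.
  by rewrite -mulr_sumr hilbert_invE eqxx mulr1 addr0.
exists kappa => //.
pose q : {poly R} := \poly_(i < n) (if insub i is Some i' then kappa i' else 0).
have sq : (size q <= n)%N by exact: size_poly.
have qE (i : 'I_n) : q`_i = kappa i by rewrite coef_poly ltn_ord valK.
have qx : q.[x] = \sum_(a < n) kappa a * x ^+ a.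
  rewrite horner_poly; apply: eq_bigr => i _; by rewrite valK.
have qq : int01 (q ^+ 2) = q.[x].
  rewrite expr2 (int01_mulE sq sq) qx exchange_big/=; apply: eq_bigr => j _.
  rewrite -kE mulr_sumr; apply: eq_bigr => i _; rewrite !qE; ring.
have := int01_sqr_ge_horner sq x01; have := int01_sqr_ge0 q; rewrite qq -qx.
move=> v0 vv; rewrite v0/=; have [->|vn0] := eqVneq q.[x] 0.
  by rewrite mulr_ge0// sqr_ge0.
have v1 : 0 < q.[x] by rewrite lt_def vn0 v0.
by rewrite -(ler_pM2r v1) -expr2.
Qed.

Section tensor.
Variables d n : nat.
Implicit Types c : {ffun 'I_d -> 'I_n} -> R.

(* [1 / (i + j + 1)] is the integral of [t^i * t^j] over [0, 1]. *)
Definition tensor_gram c c' : R := \sum_(b : {ffun 'I_d -> 'I_n})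
  \sum_(g : {ffun 'I_d -> 'I_n}) c b * c' g * \prod_k (b k + g k).+1%:R^-1.

(** If on each axis [kappa k] represents the functional with values [lambda k] on monomials, the
    product of the [kappa k] represents the product functional, and its squared norm is the product
    of the squared norms, at most [B ^+ d]. Cauchy-Schwarz then concludes. Positivity of the Gram
    form is a hypothesis because it will come from integration over the cube. *)
Lemma tensor_dual_le c (B : R) (kappa lambda : 'I_d -> 'I_n -> R) :
  (forall c, 0 <= tensor_gram c c) ->
  (forall k (a : 'I_n), \sum_(i < n) kappa k i / (i + a).+1%:R = lambda k a) ->
  (forall k, 0 <= \sum_(a < n) kappa k a * lambda k a <= B) ->
  (\sum_(b : {ffun 'I_d -> 'I_n}) c b * \prod_k lambda k (b k)) ^+ 2
  <= B ^+ d * tensor_gram c c.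
Proof.
move=> gram0 kl klB; pose K (b : {ffun 'I_d -> 'I_n}) := \prod_k kappa k (b k).
have Kc c' : tensor_gram K c' = \sum_(b : {ffun 'I_d -> 'I_n}) c' b * \prod_k lambda k (b k).
  rewrite /tensor_gram exchange_big/=; apply: eq_bigr => g _.
  under eq_bigr do rewrite mulrAC mulrC -big_split/=.
  rewrite -mulr_sumr; congr (_ * _).
  rewrite -(bigA_distr_bigA (fun k i => kappa k i / (i + g k).+1%:R)).
  by apply: eq_bigr => k _; rewrite kl.
have KK : tensor_gram K K <= B ^+ d.
  rewrite Kc /K; under eq_bigr do rewrite -big_split/=.
  rewrite -(bigA_distr_bigA (fun k i => kappa k i * lambda k i)).
  rewrite -[d in B ^+ d]card_ord -prodr_const; exact: ler_prod.
apply: le_trans (ler_wpM2r (gram0 c) KK).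
rewrite -Kc; apply: discriminant_le => u v.
have := gram0 (fun b => u * K b + v * c b).
congr (_ <= _); rewrite /tensor_gram.
have sym : tensor_gram c K = tensor_gram K c.
  rewrite /tensor_gram exchange_big/=; apply: eq_bigr => b _; apply: eq_bigr => g _.
  by rewrite [c _ * _]mulrC; under eq_bigr do rewrite addnC.
transitivity (u ^+ 2 * tensor_gram K K + u * v * tensor_gram K c +
   u * v * tensor_gram c K + v ^+ 2 * tensor_gram c c); last by rewrite sym /tensor_gram; ring.
rewrite /tensor_gram !mulr_sumr -!big_split/=; apply: eq_bigr => b _.
rewrite !mulr_sumr -!big_split/=; apply: eq_bigr => g _; ring.
Qed.

(** The case of Kronecker deltas: on axis [k] the coefficient functional is represented by row [b k]
    of the inverse Hilbert matrix, with a diagonal entry as squared norm. *)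
Lemma tensor_coef_le c (b : {ffun 'I_d -> 'I_n}) :
  (forall c, 0 <= tensor_gram c c) ->
  c b ^+ 2 <= ((2 * n)%:R ^+ (2 * n)) ^+ d * tensor_gram c c.
Proof.
move=> gram0.
have := @tensor_dual_le c ((2 * n)%:R ^+ (2 * n)) (fun k i => hilbert_inv R (b k) i)
  (fun k a => (a == b k)%:R) gram0.
rewrite (bigD1 b)//= [X in _ + X]big1 => [|g gb]; last first.
  have /existsP[k kP] : [exists k, g k != b k].
    apply: contraNT gb => /existsPn h; apply/eqP/ffunP => k.
    by have /negPn/eqP := h k.
  by rewrite (bigD1 k)//= (negPf kP) mul0r mulr0.
rewrite (eq_bigr (fun=> 1)) => [|k _]; last by rewrite eqxx.
rewrite big1_eq mulr1 addr0; apply => [k a|k]; first exact: hilbert_invE.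
rewrite (bigD1 (b k))//= eqxx mulr1 big1 => [|i /negPf ->]; last by rewrite mulr0.
by rewrite addr0 hilbert_inv_diag_ge0 hilbert_inv_diag_le.
Qed.

(** Evaluation at [x] is the product of the evaluations on the axes, each with squared norm at most
    [2 n^2]. *)
Lemma tensor_horner_le c (x : 'I_d -> R) :
  (forall c, 0 <= tensor_gram c c) -> (forall k, 0 <= x k <= 1) ->
  (\sum_(b : {ffun 'I_d -> 'I_n}) c b * \prod_k x k ^+ b k) ^+ 2
  <= (2 * n%:R ^+ 2) ^+ d * tensor_gram c c.
Proof.
move=> gram0 x01.
have /choice[kappa kP] k : exists kappa : 'I_n -> R,
    (forall a : 'I_n, \sum_(i < n) kappa i / (i + a).+1%:R = x k ^+ a) /\
    0 <= \sum_(a < n) kappa a * x k ^+ a <= 2 * n%:R ^+ 2.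
  by have [ka h1 h2] := evaluation_dual n (x01 k); exists ka.
apply: (@tensor_dual_le c _ kappa (fun k (a : 'I_n) => x k ^+ a)) => // k.
  by have [] := kP k.
by have [] := kP k.
Qed.
End tensor.
End duality.

(** * Integrals of monomials over the cube *)

Section cube_integral.
Variable R : realType.

Lemma measurable_prod_coord n (h : 'I_n -> R -> R) :
  (forall i, measurable_fun setT (h i)) ->
  measurable_fun [set: 'rV[measurableTypeR R]_n] (fun x : 'rV[R]_n => \prod_i h i (x ord0 i)).
Proof.
move=> mh; apply: measurable_prod => i _.
exact: measurableT_comp (mh i) (measurable_coord i).
Qed.

(** Induction along the recursive construction of [lebesgue_rV]: a change of variables by [cons_rV],
    then Tonelli to split off the first coordinate. *)
Lemma ge0_integral_lebesgue_rV_prod n (h : 'I_n -> R -> R) (m : 'I_n -> R) :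
  (forall i, measurable_fun setT (h i)) -> (forall i t, 0 <= h i t) ->
  (forall i, \int[lebesgue_measure]_t (h i t)%:E = (m i)%:E)%E ->
  (\int[lebesgue_rV n]_x (\prod_i h i (x ord0 i))%:E = (\prod_i m i)%:E)%E.
Proof.
elim: n h m => [|n IH] h m mh h0 hm.
  rewrite [LHS](_ : _ = \int[dirac (0%R : 'rV[R]_0)]_x (\prod_i h i (x ord0 i))%:E)%E//.
  rewrite integral_dirac//= ?diracT ?mul1e ?big_ord0//.
  by apply/measurable_EFinP; exact: measurable_prod_coord.
have h0' (x : 'rV[R]_n.+1) : 0 <= \prod_i h i (x ord0 i) by apply: prodr_ge0.
have mP := measurable_prod_coord mh.
rewrite [LHS](_ : _ = \int[pushforward (lebesgue_measure \x lebesgue_rV n) (@cons_rV R n)]_x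
  (\prod_i h i (x ord0 i))%:E)%E//.
rewrite ge0_integral_pushforward//; first last.
- by move=> y _; rewrite lee_fin.
- exact/measurable_EFinP.
- exact: measurable_cons_rV.
rewrite preimage_setT fubini_tonelli1//=; first last.
- by move=> y; rewrite lee_fin.
- apply/measurable_EFinP.
  exact: measurableT_comp mP (@measurable_cons_rV R n).
rewrite /fubini_F/=.
under eq_integral => t _.
  under eq_integral => v _.
    rewrite big_ord_recl cons_rV0/=.
    under eq_bigr do rewrite cons_rVS/=.
    rewrite EFinM.
    over.
  rewrite ge0_integralZl//=; first last.
  - by rewrite lee_fin.
  - by move=> v _; rewrite lee_fin; apply: prodr_ge0.
  - apply/measurable_EFinP; exact: (@measurable_prod_coord _ (fun i => h (lift ord0 i))).
  rewrite (IH (fun i => h (lift ord0 i)) (fun i => m (lift ord0 i)))//.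
  over.
rewrite big_ord_recl EFinM -hm ge0_integralZr//=.
- apply/measurable_EFinP; exact: mh.
- by move=> t _; rewrite lee_fin.
- rewrite lee_fin; apply: prodr_ge0 => i _.
  rewrite -lee_fin -hm; apply: integral_ge0 => t _; by rewrite lee_fin.
Qed.

Lemma unit_cube_prod_indic d (x : 'rV[R]_d) :
  \1_(unit_cube d) x = \prod_i \1_(`[0%R, 1%R]%classic) (x ord0 i) :> R.
Proof.
rewrite indicE; case: (boolP (x \in unit_cube d)) => [|] xc.
  rewrite big1// => i _; rewrite indicE mem_set//=.
  by move: xc => /set_mem /(_ i); rewrite in_itv.
have : exists i, ~~ (0 <= x ord0 i <= 1).
  apply: contrapT => h; move/negP: xc; apply; apply: mem_set => i.
  by apply/negPn/negP => hi; apply: h; exists i.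
move=> [i hi]; rewrite (bigD1 i)//= indicE memNset ?mul0r//=.
by rewrite in_itv/=; exact/negP.
Qed.

Lemma measurable_unit_cube d : measurable (unit_cube d : set 'rV[measurableTypeR R]_d).
Proof.
have -> : unit_cube d = \bigcap_(i : 'I_d) ((fun v : 'rV[R]_d => v ord0 i) @^-1` `[0%R,
  1%R]%classic).
  apply/seteqP; split=> x /= h i; first by move=> _ /=; rewrite in_itv/=; exact: h.
  by have := h i I; rewrite /= in_itv.
apply: fin_bigcap_measurable => // i _; rewrite -[X in measurable X]setTI.
by apply: (measurable_coord i) => //; exact: measurable_itv.
Qed.

(** The indicator sits inside the integrand because the product formula above is stated over the
    whole space. *)
Lemma integral01_exp n :
  (\int[lebesgue_measure]_t ((t ^+ n) * \1_(`[0%R, 1%R]%classic) t)%:E =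
   (n.+1%:R^-1 : R)%:E)%E.
Proof.
transitivity (\int[lebesgue_measure]_(t in `[0%R, 1%R]) ((t : R) ^+ n)%:E)%E.
  rewrite [RHS]integral_mkcond; apply: eq_integral => t _.
  by rewrite patchE indicE; case: (t \in _); rewrite ?mulr1 ?mulr0.
rewrite (@continuous_FTC2 _ _ (fun x => x ^+ n.+1 * n.+1%:R^-1))//=.
- by rewrite expr1n expr0n/= mul0r mul1r sube0.
- by apply: continuous_in_subspaceT => x _; exact: exprn_continuous.
- split.
  + by move=> x _; apply: derivableM => //; exact: exprn_derivable.
  + apply: cvgM; last exact: cvg_cst.
    by apply: cvg_at_right_filter; exact: exprn_continuous.
  + apply: cvgM; last exact: cvg_cst.
    by apply: cvg_at_left_filter; exact: exprn_continuous.
- move=> x _; rewrite derive1Mr//; last exact: exprn_derivable.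
  rewrite derive1E exp_derive -[RHS]mul1r -[_%:A]/(_ * 1) mulr1 -[_ *: _]/(_ * _).
  by rewrite mulrAC divff // pnatr_eq0.
Qed.

Lemma integral_unit_cube_monomial d (e : 'I_d -> nat) :
  (\int[lebesgue_rV d]_(x in unit_cube d) (\prod_i x ord0 i ^+ e i)%:E
   = (\prod_i (e i).+1%:R^-1 : R)%:E)%E.
Proof.
pose h i (t : R) := t ^+ e i * \1_(`[0%R, 1%R]%classic) t.
rewrite integral_mkcond.
rewrite -(@ge0_integral_lebesgue_rV_prod d h)//; last 3 first.
- move=> i; apply: measurable_funM => //; exact: measurable_indic.
- move=> i t; rewrite /h indicE; case: (boolP (t \in _)) => [/set_mem/=|]; rewrite ?mulr0//.
  by rewrite in_itv/= mulr1 => /andP[t0 _]; rewrite exprn_ge0.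
- by move=> i; rewrite integral01_exp.
apply: eq_integral => x _; rewrite /h big_split/= -unit_cube_prod_indic.
by rewrite patchE indicE; case: (x \in _); rewrite ?mulr1 ?mulr0.
Qed.

End cube_integral.

(** * Mercer-type expansions of integral forms *)

Section real_integral.
Context disp (T : measurableType disp) (R : realType).
Variables (mu : {measure set T -> \bar R}) (D : set T).
Hypothesis mD : measurable D.
Implicit Types f g : T -> R.

Lemma integrable_EFin_measurable f : mu.-integrable D (EFin \o f) -> measurable_fun D f.
Proof. by move=> /measurable_int/measurable_EFinP. Qed.

Lemma integrable_EFinZl a f : mu.-integrable D (EFin \o f) ->
  mu.-integrable D (EFin \o (fun x => a * f x)).
Proof. by move=> /(integrableZl mD a); apply: eq_integrable => // x _; rewrite /= EFinM. Qed.

Lemma integrable_EFinD f g : mu.-integrable D (EFin \o f) -> mu.-integrable D (EFin \o g) ->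
  mu.-integrable D (EFin \o (fun x => f x + g x)).
Proof. by move=> h1 h2; apply: eq_integrable (integrableD mD h1 h2) => // x _. Qed.

Lemma integrable_EFin_sum (I : Type) (s : seq I) (f : I -> T -> R) :
  (forall i, mu.-integrable D (EFin \o f i)) ->
  mu.-integrable D (EFin \o (fun x => \sum_(i <- s) f i x)).
Proof.
move=> h; apply: eq_integrable (@integrable_sum _ _ _ mu D mD I s xpredT
  (fun i => EFin \o f i) (fun i _ => h i)) => //.
by move=> x _; rewrite /= sumEFin.
Qed.

Lemma Rintegral_sum (I : Type) (s : seq I) (f : I -> T -> R) :
  (forall i, mu.-integrable D (EFin \o f i)) ->
  \int[mu]_(x in D) (\sum_(i <- s) f i x) = \sum_(i <- s) \int[mu]_(x in D) f i x.
Proof.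
move=> h; elim: s => [|i s IH].
  by under eq_Rintegral do rewrite big_nil; rewrite Rintegral_cst// mul0r big_nil.
under eq_Rintegral do rewrite big_cons.
by rewrite RintegralD ?IH ?big_cons//; exact: integrable_EFin_sum.
Qed.

Lemma le_integrable_EFin f g : measurable_fun D f -> (forall x, D x -> `|f x| <= g x) ->
  mu.-integrable D (EFin \o g) -> mu.-integrable D (EFin \o f).
Proof.
move=> mf fg; apply: le_integrable => //; first exact/measurable_EFinP.
by move=> x Dx /=; rewrite lee_fin (le_trans (fg _ Dx))// ler_norm.
Qed.

Lemma integrable_mul_sqr f g : measurable_fun D f -> measurable_fun D g ->
  mu.-integrable D (EFin \o (fun x => f x ^+ 2)) ->
  mu.-integrable D (EFin \o (fun x => g x ^+ 2)) ->
  mu.-integrable D (EFin \o (fun x => f x * g x)).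
Proof.
move=> mf mg f2 g2; apply: (@le_integrable_EFin _ (fun x => f x ^+ 2 + g x ^+ 2)).
- exact: measurable_funM.
- move=> x _; rewrite normrM -(real_normK (num_real (f x))) -(real_normK (num_real (g x))).
  have := sqr_ge0 (`|f x| - `|g x|); have := normr_ge0 (f x); have := normr_ge0 (g x); nra.
- exact: integrable_EFinD.
Qed.

Lemma Rintegral_dominated_cvg (fn : nat -> T -> R) f g :
  (forall n, measurable_fun D (fn n)) ->
  (forall x, D x -> fn n x @[n --> \oo] --> f x) ->
  (forall n x, D x -> `|fn n x| <= g x) ->
  mu.-integrable D (EFin \o g) ->
  mu.-integrable D (EFin \o f) /\
  \int[mu]_(x in D) fn n x @[n --> \oo] --> \int[mu]_(x in D) f x.
Proof.
move=> mfn fnf fng ig.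
have mf : measurable_fun D f by apply: (@measurable_fun_cvg _ _ _ _ fn).
have fif : mu.-integrable D (EFin \o f).
  apply: le_integrable_EFin ig => // x Dx.
  have h : `|fn n x| @[n --> \oo] --> `|f x| by apply: cvg_norm; exact: fnf.
  rewrite -(cvg_lim _ h)//; apply: limr_le; first by apply/cvg_ex; exists `|f x|.
  by apply: nearW => n; exact: fng.
have C : (\int[mu]_(x in D) ((EFin \o fn n) x) @[n --> \oo] -->
    \int[mu]_(x in D) ((EFin \o f) x))%E.
  apply: (@dominated_cvg _ _ _ mu D mD (fun n => EFin \o fn n) (EFin \o f) (EFin \o g)).
  - by move=> n; exact/measurable_EFinP.
  - by move=> x Dx; apply: cvg_EFin; [exact: nearW|exact: fnf].
  - by [].
  - by [].
  - by move=> n x Dx; rewrite /= lee_fin; exact: fng.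
split=> //; rewrite /Rintegral; apply: fine_cvg.
by rewrite fineK//; exact: integrable_fin_num.
Qed.

End real_integral.

Section kernel_expansion.
Context disp (T : measurableType disp) (R : realType).
Variables (mu : {measure set T -> \bar R}) (D : set T).
Hypothesis mD : measurable D.
Variables (k : T -> T -> R) (I : Type) (a : I -> R) (u : I -> T -> R).
Variables (r : nat -> seq I) (C : R) (F : T -> R).
(** Partial sums run along arbitrary finite lists over an abstract index type, so that the same
    lemmas serve the Taylor series, indexed by words, and the Mercer series, indexed by integers.
    The uniform bound [C] is what dominated convergence needs. *)
Let K M z y := \sum_(i <- r M) a i * u i z * u i y.
Hypothesis mu_ : forall i, measurable_fun D (u i).
Hypothesis Kk : forall z y, D z -> D y -> K M z y @[M --> \oo] --> k z y.
Hypothesis KC : forall M z y, D z -> D y -> `|K M z y| <= C.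
Hypothesis iF : mu.-integrable D (EFin \o F).
Hypothesis iuF : forall i, mu.-integrable D (EFin \o (fun z => u i z * F z)).

Lemma kernel_expansion_section_cvg y : D y ->
  mu.-integrable D (EFin \o (fun z => k z y * F z)) /\
  \sum_(i <- r M) a i * \int[mu]_(z in D) (u i z * F z) * u i y @[M --> \oo] -->
  \int[mu]_(z in D) (k z y * F z).
Proof.
move=> Dy.
have KE M z : K M z y * F z = \sum_(i <- r M) (a i * u i y) * (u i z * F z).
  by rewrite /K mulr_suml; apply: eq_bigr => i _; ring.
have iK M : mu.-integrable D (EFin \o (fun z => K M z y * F z)).
  have -> : (fun z => K M z y * F z) = (fun z => \sum_(i <- r M) (a i * u i y) * (u i z * F z)).
    by apply/funext => z; exact: KE.
  by apply: integrable_EFin_sum => // i; exact: integrable_EFinZl.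
have := @Rintegral_dominated_cvg _ _ _ mu D mD (fun M z => K M z y * F z)
  (fun z => k z y * F z) (fun z => C * `|F z|).
case.
- by move=> M; exact: (integrable_EFin_measurable (iK M)).
- by move=> z Dz; apply: cvgM; [exact: Kk | exact: cvg_cst].
- by move=> M z Dz; rewrite normrM ler_wpM2r// KC.
- by apply: integrable_EFinZl => //; exact: integrable_norm.
move=> ik cv; split=> //; move: cv.
under eq_fun => M.
  under eq_Rintegral do rewrite KE.
  rewrite Rintegral_sum//; last by move=> i; exact: integrable_EFinZl.
  under eq_bigr => i _ do rewrite RintegralZl// mulrAC.
  over.
by [].
Qed.

(** A second dominated convergence: the sections integrated in [z] are bounded by [B = C * int |F|]
    uniformly in [M] and [y], so [B * |F|] dominates. *)
Lemma kernel_expansion_form_cvg :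
  \sum_(i <- r M) a i * (\int[mu]_(z in D) (u i z * F z)) ^+ 2 @[M --> \oo] -->
  \int[mu]_(y in D) (\int[mu]_(z in D) (k z y * F z) * F y).
Proof.
pose g M y := \sum_(i <- r M) a i * \int[mu]_(z in D) (u i z * F z) * u i y.
pose B := C * \int[mu]_(z in D) `|F z|.
have gE M y : g M y = \int[mu]_(z in D) (K M z y * F z).
  rewrite (_ : (fun z => K M z y * F z) =
      (fun z => \sum_(i <- r M) (a i * u i y) * (u i z * F z))).
    rewrite Rintegral_sum//; last by move=> i; exact: integrable_EFinZl.
    by apply: eq_bigr => i _; rewrite RintegralZl// mulrAC.
  by apply/funext => z; rewrite /K mulr_suml; apply: eq_bigr => i _; ring.
have gB M y : D y -> `|g M y| <= B.
  move=> Dy; have iK : mu.-integrable D (EFin \o (fun z => K M z y * F z)).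
    rewrite (_ : (fun z => K M z y * F z) =
        (fun z => \sum_(i <- r M) (a i * u i y) * (u i z * F z))).
      by apply: integrable_EFin_sum => // i; exact: integrable_EFinZl.
    by apply/funext => z; rewrite /K mulr_suml; apply: eq_bigr => i _; ring.
  rewrite gE (le_trans (le_normr_Rintegral _ _))// /B -RintegralZl//;
    last exact: integrable_norm.
  apply: le_Rintegral => //; first exact: integrable_norm.
    by apply: integrable_EFinZl => //; exact: integrable_norm.
  by move=> z Dz; rewrite normrM ler_wpM2r// KC.
have gFE M y : g M y * F y =
    \sum_(i <- r M) a i * \int[mu]_(z in D) (u i z * F z) * (u i y * F y).
  by rewrite /g mulr_suml; apply: eq_bigr => i _; rewrite mulrA.
have := @Rintegral_dominated_cvg _ _ _ mu D mD (fun M y => g M y * F y)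
  (fun y => \int[mu]_(z in D) (k z y * F z) * F y) (fun y => B * `|F y|).
case.
- move=> M; apply: measurable_funM; last exact: (integrable_EFin_measurable iF).
  by apply: measurable_sum => i; apply: measurable_funM => //; exact: measurable_cst.
- by move=> y Dy; apply: cvgM; [exact: (kernel_expansion_section_cvg Dy).2 | exact: cvg_cst].
- by move=> M y Dy; rewrite normrM ler_wpM2r// gB.
- by apply: integrable_EFinZl => //; exact: integrable_norm.
move=> _.
under eq_fun => M.
  under eq_Rintegral do rewrite gFE.
  rewrite Rintegral_sum//; last by move=> i; exact: integrable_EFinZl.
  under eq_bigr => i _ do rewrite RintegralZl// -mulrA -expr2.
  over.
by [].
Qed.

(** With nonnegative coefficients every term of the limit is nonnegative, so a single term is a
    lower bound as soon as its index occurs in [r M] for all large [M]. *)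
Lemma kernel_expansion_form_ge i : (forall i, 0 <= a i) ->
  (\forall M \near \oo, exists s s', r M = s ++ i :: s') ->
  a i * (\int[mu]_(z in D) (u i z * F z)) ^+ 2 <=
  \int[mu]_(y in D) (\int[mu]_(z in D) (k z y * F z) * F y).
Proof.
move=> a0 ir; have h := kernel_expansion_form_cvg.
rewrite -(cvg_lim _ h)//; apply: limr_ge; first by apply/cvg_ex; eexists; exact: h.
near=> M; have [|s [s' ->]] := near ir M; first by [].
rewrite big_cat big_cons/=.
have p0 (t : seq I) : 0 <= \sum_(i <- t) a i * (\int[mu]_(z in D) (u i z * F z)) ^+ 2.
  by apply: sumr_ge0 => j _; rewrite mulr_ge0 ?sqr_ge0.
have := p0 s; have := p0 s'; lra.
Unshelve. all: by end_near. Qed.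

End kernel_expansion.

(** * Bessel's inequality and the form on the orthogonal complement of the first eigenfunctions *)

Section spectral_bound.
Context disp (T : measurableType disp) (R : realType).
Variables (mu : {measure set T -> \bar R}) (D : set T).
Hypothesis mD : measurable D.
Variables (psi : nat -> T -> R) (f : T -> R).
Hypothesis mpsi : forall i, measurable_fun D (psi i).
Hypothesis ipsi : forall i, mu.-integrable D (EFin \o (fun x => psi i x ^+ 2)).
Hypothesis opsi : forall i j, \int[mu]_(x in D) (psi i x * psi j x) = (i == j)%:R.
Hypothesis mf : measurable_fun D f.
Hypothesis if1 : mu.-integrable D (EFin \o f).
Hypothesis if2 : mu.-integrable D (EFin \o (fun x => f x ^+ 2)).

Lemma bessel_le n : \sum_(i < n) (\int[mu]_(x in D) (psi i x * f x)) ^+ 2 <=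
  \int[mu]_(x in D) (f x ^+ 2).
Proof.
pose c i := \int[mu]_(x in D) (psi i x * f x).
pose S x := \sum_(i < n) c i * psi i x.
have ipf i : mu.-integrable D (EFin \o (fun x => psi i x * f x)) by exact: integrable_mul_sqr.
have ipp i j : mu.-integrable D (EFin \o (fun x => psi i x * psi j x)) by exact:
  integrable_mul_sqr.
have E x : (f x - S x) ^+ 2 = f x ^+ 2 + \sum_(i < n) (- 2 * c i) * (psi i x * f x)
    + \sum_(i < n) \sum_(j < n) (c i * c j) * (psi i x * psi j x).
  have -> : \sum_(i < n) (- 2 * c i) * (psi i x * f x) = - 2 * S x * f x.
    by rewrite /S mulr_sumr mulr_suml; apply: eq_bigr => i _; ring.
  have -> : \sum_(i < n) \sum_(j < n) (c i * c j) * (psi i x * psi j x) = S x * S x.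
    rewrite /S mulr_suml; apply: eq_bigr => i _; rewrite mulr_sumr.
    by apply: eq_bigr => j _; ring.
  ring.
have : 0 <= \int[mu]_(x in D) ((f x - S x) ^+ 2) by apply: Rintegral_ge0 => x _; exact: sqr_ge0.
under eq_Rintegral do rewrite E.
have i1 : mu.-integrable D (EFin \o (fun x => \sum_(i < n) (- 2 * c i) * (psi i x * f x))).
  by apply: integrable_EFin_sum => // i; exact: integrable_EFinZl.
have i2 i : mu.-integrable D
    (EFin \o (fun x => \sum_(j < n) (c i * c j) * (psi i x * psi j x))).
  by apply: integrable_EFin_sum => // j; exact: integrable_EFinZl.
have i3 : mu.-integrable D
    (EFin \o (fun x => \sum_(i < n) \sum_(j < n) (c i * c j) * (psi i x * psi j x))).
  exact: integrable_EFin_sum.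
rewrite !RintegralD//; last exact: integrable_EFinD.
rewrite !Rintegral_sum//; last by move=> i; exact: integrable_EFinZl.
have -> : \sum_(i < n) \int[mu]_(x in D) (- 2 * c i * (psi i x * f x)) =
    - 2 * \sum_(i < n) c i ^+ 2.
  by rewrite mulr_sumr; apply: eq_bigr => i _; rewrite RintegralZl// -/(c i); ring.
have -> : \sum_(i < n) \int[mu]_(x in D) (\sum_(j < n) c i * c j * (psi i x * psi j x))
    = \sum_(i < n) c i ^+ 2.
  apply: eq_bigr => i _; rewrite Rintegral_sum//; last by move=> j; exact: integrable_EFinZl.
  rewrite (bigD1 i)//= big1 => [|j ji].
    by rewrite RintegralZl// opsi eqxx mulr1 addr0 expr2.
  rewrite RintegralZl// opsi; case: eqP => [/val_inj ij|_]; last by rewrite mulr0.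
  by rewrite ij eqxx in ji.
rewrite -/(c _); lra.
Qed.

Variables (k : T -> T -> R) (nu : nat -> R).
Hypothesis nu0 : forall i, 0 <= nu i.
Hypothesis nu_decr : forall i, nu i.+1 <= nu i.
Hypothesis psik : forall x y, D x -> D y ->
  \sum_(i < n) nu i * psi i x * psi i y @[n --> \oo] --> k x y.
Hypothesis k1 : forall x, D x -> k x x <= 1.

(** In the expansion of the form the terms below [L] vanish, the other eigenvalues are at most
    [nu L], and Bessel's inequality bounds the remaining sum of squares. *)
Lemma spectral_form_le L :
  (forall i, (i < L)%N -> \int[mu]_(x in D) (psi i x * f x) = 0) ->
  \int[mu]_(y in D) (\int[mu]_(z in D) (k z y * f z) * f y) <=
  nu L * \int[mu]_(x in D) (f x ^+ 2).
Proof.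
move=> fpsi.
(* Source of the dominating constant 1: on the diagonal the partial sums increase to [k x x <= 1],
   and [2 |a b| <= a^2 + b^2] carries the bound to all pairs. *)
have diag n x : D x -> \sum_(i < n) nu i * psi i x * psi i x <= 1.
  move=> Dx; apply: le_trans (k1 Dx).
  have cv := psik Dx Dx; rewrite -(cvg_lim _ cv)//.
  apply: (@nondecreasing_cvgn_le _ (fun n => \sum_(i < n) nu i * psi i x * psi i x));
    last first.
    by apply/cvg_ex; eexists; exact: cv.
  apply/nondecreasing_seqP => m; rewrite big_ord_recr/= lerDl -mulrA -expr2.
  by rewrite mulr_ge0 ?sqr_ge0.
have h := @kernel_expansion_form_cvg _ T R mu D mD k nat nu psi (fun n => index_iota 0 n) 1 f.
have {h} : \sum_(i < n) nu i * (\int[mu]_(x in D) (psi i x * f x)) ^+ 2 @[n --> \oo] -->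
    \int[mu]_(y in D) (\int[mu]_(z in D) (k z y * f z) * f y).
  under eq_fun do rewrite -(big_mkord xpredT
    (fun i => nu i * (\int[mu]_(x in D) (psi i x * f x)) ^+ 2)).
  apply: h => //.
  - by move=> z y Dz Dy; under eq_fun do rewrite big_mkord; exact: psik.
  - move=> n z y Dz Dy; rewrite big_mkord.
    apply: (@le_trans _ _ (2^-1 * (\sum_(i < n) nu i * psi i z * psi i z + \sum_(i < n) nu
      i * psi i y * psi i y))).
      rewrite (le_trans (ler_norm_sum _ _ _))// -big_split mulr_sumr; apply: ler_sum => i _ /=.
      rewrite !normrM (ger0_norm (nu0 i)).
      have -> : nu i * psi i z * psi i z = nu i * `|psi i z| ^+ 2 by rewrite real_normK
        ?num_real//; ring.
      have -> : nu i * psi i y * psi i y = nu i * `|psi i y| ^+ 2 by rewrite real_normK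
        ?num_real//; ring.
      have := nu0 i; have := sqr_ge0 (`|psi i z| - `|psi i y|); nra.
    have := diag n z Dz; have := diag n y Dy; lra.
  - by move=> i; exact: integrable_mul_sqr.
move=> h; rewrite -(cvg_lim _ h)//; apply: limr_le; first by apply/cvg_ex; eexists; exact: h.
apply: nearW => n; have nuL i : (L <= i)%N -> nu i <= nu L.
  by move=> Li; rewrite -(subnK Li); elim: (i - L)%N => // m IH; exact: le_trans (nu_decr _) IH.
apply: le_trans (_ : \sum_(i < n) nu L * (\int[mu]_(x in D) (psi i x * f x)) ^+ 2 <= _);
  last first.
  by rewrite -mulr_sumr ler_wpM2l// bessel_le.
apply: ler_sum => i _; case: (ltnP i L) => [iL|Li]; first by rewrite fpsi// expr0n !mulr0.
by rewrite ler_wpM2r ?sqr_ge0// nuL.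
Qed.

End spectral_bound.

(** * Measures given by a density *)

Section density.
Context disp (T : measurableType disp) (R : realType).
Variables (mu nu : {measure set T -> \bar R}) (D : set T) (p : T -> R).
Hypothesis mD : measurable D.
Hypothesis mp : measurable_fun D p.
Hypothesis p0 : forall x, D x -> 0 <= p x.
Hypothesis nuE : forall A, measurable A -> nu A = (\int[mu]_(x in A `&` D) (p x)%:E)%E.

Import HBNNSimple.
Local Open Scope ereal_scope.

(** [nuE] is the case of indicators; linearity gives simple functions, and monotone convergence on
    both sides gives the rest. *)
Lemma ge0_integral_density (f : T -> \bar R) : measurable_fun D f ->
  (forall x, D x -> 0 <= f x) ->
  \int[nu]_(x in D) f x = \int[mu]_(x in D) (f x * (p x)%:E).
Proof.
move=> mf f0; pose h := nnsfun_approx mD mf.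
have mhn n : measurable_fun D (EFin \o h n).
  apply/measurable_EFinP; apply: (measurable_funS measurableT) => //.
transitivity (lim (\int[nu]_(x in D) (EFin \o h n) x @[n --> \oo])).
  rewrite -monotone_convergence//.
  - apply: eq_integral => x /[!inE] Dx; apply/esym/cvg_lim => //.
    exact: cvg_nnsfun_approx.
  - by move=> n x Dx /=; rewrite lee_fin.
  - by move=> x Dx a b ab; rewrite lee_fin; exact/lefP/nd_nnsfun_approx.
transitivity (lim (\int[mu]_(x in D) ((EFin \o h n) x * (p x)%:E) @[n --> \oo])); last first.
  rewrite -monotone_convergence//.
  - apply: eq_integral => x /[!inE] Dx; apply/cvg_lim => //.
    by apply: cvgeZr => //; exact: cvg_nnsfun_approx.
  - by move=> n; apply: emeasurable_funM => //; exact/measurable_EFinP.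
  - by move=> n x Dx /=; rewrite mule_ge0// lee_fin// p0.
  - move=> x Dx a b ab /=; rewrite lee_wpmul2r ?lee_fin ?p0//.
    exact/lefP/nd_nnsfun_approx.
suff E n : \int[nu]_(x in D) (EFin \o h n) x =
    \int[mu]_(x in D) ((EFin \o h n) x * (p x)%:E).
  by under eq_fun do rewrite E.
transitivity (\int[nu]_(x in D)
   (\sum_(y \in range (h n)) (y * \1_(h n @^-1` [set y]) x)%:E)).
  by apply: eq_integral => t tE; rewrite /= fimfunE -fsumEFin.
have indich r : measurable_fun D (fun x => (r * \1_(h n @^-1` [set r]) x)%:E).
  by apply: (measurable_comp measurableT) => //; exact: measurable_funM.
rewrite ge0_integral_fsum//; last by move=> m y Ey; exact: nnfun_muleindic_ge0.
transitivity (\int[mu]_(x in D) (\sum_(y \in range (h n))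
    (y * \1_(h n @^-1` [set y]) x)%:E * (p x)%:E)); last first.
  apply: eq_integral => x xD.
  rewrite -ge0_mule_fsuml => [|y]; last exact: nnfun_muleindic_ge0.
  by rewrite fsumEFin // -(fimfunE _ x).
rewrite ge0_integral_fsum//; last 2 first.
  - by move=> y; apply: emeasurable_funM => //; exact/measurable_EFinP.
  - move=> y x Dx; apply: mule_ge0; last by rewrite lee_fin p0.
    exact: nnfun_muleindic_ge0.
apply: eq_fsbigr => r rhn.
under eq_integral do rewrite EFinM.
rewrite integralZl_indic_nnsfun => //.
under [RHS]eq_integral do rewrite EFinM -muleA.
rewrite ge0_integralZl//.
- congr (_ * _); rewrite integral_indic// nuE; last exact: measurableI.
  rewrite -setIA setIid integral_mkcondl; apply: eq_integral => x xD.
  by rewrite patchE indicE; case: (x \in _); rewrite ?mul1e ?mul0e.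
- apply: emeasurable_funM; last exact/measurable_EFinP.
  by apply/measurable_EFinP; apply: measurable_indic.
- by move=> t Et; rewrite mule_ge0 ?lee_fin ?p0.
- by move: rhn; rewrite inE => -[t _ <-]; rewrite lee_fin.
Qed.

Lemma integral_density (f : T -> R) : measurable_fun D f ->
  \int[nu]_(x in D) (f x)%:E = \int[mu]_(x in D) (f x * p x)%:E.
Proof.
move=> mf; have mfE : measurable_fun D (EFin \o f) by exact/measurable_EFinP.
rewrite [LHS]integralE [RHS]integralE.
rewrite !ge0_integral_density//; do ?exact: measurable_funepos; do ?exact: measurable_funeneg.
congr (_ - _); apply: eq_integral => x /[!inE] Dx.
- by rewrite !funeposE EFinM maxe_pMl ?mul0e ?mulNe ?lee_fin ?p0//.
- by rewrite !funenegE EFinM maxe_pMl ?mul0e ?mulNe ?lee_fin ?p0//.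
Qed.

(** With [c] a positive lower bound of the density, this controls Lebesgue mean squares of
    polynomials by their mean squares under [P]. *)
Lemma ge0_integral_density_ge (f : T -> R) (c : R) : measurable_fun D f ->
  (forall x, D x -> 0 <= f x)%R -> (0 <= c)%R -> (forall x, D x -> c <= p x)%R ->
  c%:E * \int[mu]_(x in D) (f x)%:E <= \int[nu]_(x in D) (f x)%:E.
Proof.
move=> mf f0 c0 cp; have mfE : measurable_fun D (EFin \o f) by exact/measurable_EFinP.
rewrite ge0_integral_density// -ge0_integralZl//.
apply: ge0_le_integral => //.
- by move=> x Dx; rewrite mule_ge0 ?lee_fin ?f0.
- by apply: emeasurable_funM.
- by apply: emeasurable_funM => //; exact/measurable_EFinP.
- by move=> x Dx; rewrite -!EFinM lee_fin mulrC ler_wpM2l ?f0 ?cp.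
Qed.

End density.

(** * Continuous functions on the cube are measurable *)

Section continuous_measurable.
Variables (R : realType) (d : nat).

(** A neighbourhood of a row vector contains a product of finitely many coordinate neighbourhoods,
    so coordinatewise convergence suffices. *)
Lemma subspace_cvg_seq (A : set 'rV[R]_d) (f : 'rV[R]_d -> R) x (y : nat -> 'rV[R]_d) :
  {within A, continuous f} -> A x -> (forall n, A (y n)) ->
  (forall i, y n ord0 i @[n --> \oo] --> x ord0 i) ->
  f (y n) @[n --> \oo] --> f x.
Proof.
move=> /subspace_continuousP cf Ax Ay yx.
apply: cvg_trans (cf _ Ax).
move=> U; rewrite /within/= => -[e /= e0 eU].
have : \forall n \near \oo, forall i, e ord0 i (y n ord0 i).
  by apply: filter_forall => i; exact: (yx i _ (e0 ord0 i)).
rewrite !near_simpl/=; apply: filterS => n h /=.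
apply: eU => //= i j; rewrite (ord1 i); exact: h.
Qed.

(* [f] is the pointwise limit of its values at the grid points below [x]. *)
Lemma measurable_unit_cube_continuous (f : 'rV[R]_d -> R) :
  {within unit_cube d, continuous f} ->
  measurable_fun (unit_cube d : set 'rV[measurableTypeR R]_d) f.
Proof.
move=> cf.
(* There are [n.+2] nodes per axis, because the coordinate 1 lies in the half-open cell starting at
   node [n.+1]; that node still belongs to the cube. *)
pose node n (b : {ffun 'I_d -> 'I_n.+2}) : 'rV[R]_d := \row_i ((b i)%:R / n.+1%:R).
pose cell n (j : nat) : set R := `[j%:R / n.+1%:R, j.+1%:R / n.+1%:R[%classic.
pose fn n (x : 'rV[R]_d) : R := \sum_b f (@node n b) * \prod_i \1_(cell n (b i)) (x ord0 i).
apply: (@measurable_fun_cvg _ _ _ _ fn).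
- move=> n; apply: measurable_funTS; apply: measurable_sum => b.
  apply: measurable_funM; first exact: measurable_cst.
  apply: (@measurable_prod_coord R d (fun i => \1_(cell n (b i)))) => i.
  by apply: measurable_indic; exact: measurable_itv.
move=> x xc.
have N0 n : 0 < n.+1%:R :> R by [].
have itv n i : (Num.truncn (n.+1%:R * x ord0 i))%:R <= n.+1%:R * x ord0 i <
    (Num.truncn (n.+1%:R * x ord0 i)).+1%:R.
  by apply: truncn_itv; rewrite mulr_ge0//; have /andP[] := xc i.
have tr n i : (Num.truncn (n.+1%:R * x ord0 i) < n.+2)%N.
  rewrite truncn_lt_nat; last by rewrite mulr_ge0//; have /andP[] := xc i.
  by rewrite -natr1; have /andP[_ x1] := xc i; have := N0 n; nra.
pose b n := [ffun i => Ordinal (tr n i)].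
have cellE n i (j : 'I_n.+2) : \1_(cell n j) (x ord0 i) = (j == b n i)%:R :> R.
  rewrite indicE; congr ((nat_of_bool _)%:R); rewrite ffunE -val_eqE/= eq_sym truncn_eq;
    last first.
    by rewrite mulr_ge0//; have /andP[] := xc i.
  apply/idP/idP; [move=> /set_mem | move=> h; apply/mem_set; move: h];
  by rewrite /cell /= in_itv/= ler_pdivrMr// ltr_pdivlMr// mulrC.
have fny n : fn n x = f (node n (b n)).
  rewrite /fn (bigD1 (b n))//= [X in _ + X]big1 => [|c cb].
    rewrite big1 ?mulr1 ?addr0// => i _; by rewrite cellE eqxx.
  have /existsP[i iP] : [exists i, c i != b n i].
    apply: contraNT cb => /existsPn h; apply/eqP/ffunP => i.
    by have /negPn/eqP := h i.
  by rewrite (bigD1 i)//= cellE (negPf iP) mul0r mulr0.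
under eq_fun do rewrite fny.
apply: (subspace_cvg_seq cf xc).
  move=> n i; rewrite mxE ffunE/= divr_ge0//= ler_pdivrMr// mul1r.
  have /andP[h _] := itv n i; have /andP[_ x1] := xc i; have := N0 n; nra.
move=> i; apply/cvgrPdist_le => e e0.
near=> n; rewrite mxE ffunE/=.
have /andP[h1 h2] := itv n i.
have ne : 1 <= n.+1%:R * e.
  rewrite -ler_pdivrMr// div1r (@le_trans _ _ n%:R) ?ler_nat//; near: n.
  exact: nbhs_infty_ger.
rewrite -(ler_pM2l (N0 n)) -{1}(ger0_norm (ltW (N0 n))) -normrM mulrBr mulrCA divff
  ?mulr1// ?gt_eqF//.
rewrite ger0_norm ?subr_ge0//; apply: le_trans ne.
by rewrite lerBlDl natr1 ltW.
Unshelve. all: by end_near. Qed.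
End continuous_measurable.

(** * Taylor expansion of the Gaussian kernel *)

Section exp_tail.
Variable R : realType.
Implicit Type t : R.

Lemma exp_partial_sum_cvg t : \sum_(m < M) t ^+ m / m`!%:R @[M --> \oo] --> expR t.
Proof.
have h := @is_cvg_series_exp_coeff R t.
under eq_fun do rewrite -(big_mkord xpredT (fun m => t ^+ m / m`!%:R)).
exact: h.
Qed.

Lemma exp_partial_sum_le t M : 0 <= t -> \sum_(m < M) t ^+ m / m`!%:R <= expR t.
Proof.
move=> t0; have cv := @exp_partial_sum_cvg t; rewrite -(cvg_lim _ cv)//.
apply: (@nondecreasing_cvgn_le _ (fun M => \sum_(m < M) t ^+ m / m`!%:R)); last first.
  by apply/cvg_ex; eexists; exact: cv.
apply/nondecreasing_seqP => m; rewrite big_ord_recr/= lerDl.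
by rewrite divr_ge0// exprn_ge0.
Qed.

(** Since [M! j! <= (M + j)!], the tail from [M] on is at most [t^M / M!] times the whole series. *)
Lemma exp_tail_le t M : 0 <= t ->
  `|expR t - \sum_(m < M) t ^+ m / m`!%:R| <= t ^+ M / M`!%:R * expR t.
Proof.
move=> t0; rewrite ger0_norm ?subr_ge0 ?exp_partial_sum_le// lerBlDr.
have cv := @exp_partial_sum_cvg t; rewrite -{1}(cvg_lim _ cv)//.
apply: limr_le; first by apply/cvg_ex; eexists; exact: cv.
exists M => // N /= MN; rewrite -(subnKC MN) big_split_ord/= addrC lerD2r.
apply: le_trans (ler_wpM2l _ (exp_partial_sum_le (N - M) t0)); last first.
  by rewrite divr_ge0// exprn_ge0.
rewrite mulr_sumr; apply: ler_sum => j _; rewrite exprD mulrACA -invfM.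
rewrite ler_wpM2l ?mulr_ge0 ?exprn_ge0//.
rewrite lef_pV2 ?posrE -?natrM ?ltr0n ?muln_gt0 ?fact_gt0// ler_nat.
rewrite -(@bin_fact (M + j) M) ?leq_addr// addKn leq_pmull// bin_gt0 leq_addr//.
Qed.
End exp_tail.

Section words.
Variables (R : realType) (d : nat).
Implicit Types x y z : 'rV[R]_d.

(* Expanding [<x, y>^m] over all words of length [m] avoids multinomial
   coefficients. *)
Fixpoint words m : seq (seq 'I_d) :=
  if m is m'.+1 then [seq i :: s | i <- enum 'I_d, s <- words m'] else [:: [::]].

Definition words_below M := flatten [seq words m | m <- iota 0 M].

Definition word_monomial (s : seq 'I_d) x := \prod_(i <- s) x ord0 i.

Lemma size_words m s : s \in words m -> size s = m.
Proof.
elim: m s => [|m IH] s /=; first by rewrite inE => /eqP->.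
by move=> /allpairsP[[i t] /= [_ ts ->]] /=; rewrite IH.
Qed.

Lemma mem_words s : s \in words (size s).
Proof.
elim: s => [|i s IH] /=; first by rewrite inE.
by apply: allpairs_f => //; rewrite mem_enum.
Qed.

Lemma mem_words_below s M : (size s < M)%N -> s \in words_below M.
Proof.
move=> sM; apply/flattenP; exists (words (size s)); last exact: mem_words.
by apply: map_f; rewrite mem_iota.
Qed.

Lemma size_words_below s M : s \in words_below M -> (size s < M)%N.
Proof.
move=> /flattenP[t /mapP[m]]; rewrite mem_iota/= => mM -> /size_words ->.
by rewrite add0n in mM.
Qed.

Lemma exp_dot_words x y m : (\sum_i x ord0 i * y ord0 i) ^+ m =
  \sum_(s <- words m) word_monomial s x * word_monomial s y.
Proof.
elim: m => [|m IH] /=; first by rewrite big_seq1 /word_monomial !big_nil mulr1.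
rewrite exprS IH mulr_suml big_allpairs_dep big_enum/=; apply: eq_bigr => i _.
rewrite mulr_sumr; apply: eq_bigr => s _; rewrite /word_monomial !big_cons; ring.
Qed.

Lemma sum_words_below (F : seq 'I_d -> R) M :
  \sum_(s <- words_below M) F s = \sum_(m < M) \sum_(s <- words m) F s.
Proof.
rewrite big_flatten big_map -(big_mkord xpredT (fun m => \sum_(s <- words m) F s)).
by rewrite /index_iota subn0.
Qed.

Lemma word_monomial_itv s x : unit_cube d x -> 0 <= word_monomial s x <= 1.
Proof.
move=> xc; apply/andP; split.
  by apply: prodr_ge0 => i _; have /andP[] := xc i.
by apply: prodr_ile1 => i _; exact: xc.
Qed.

Lemma measurable_word_monomial s (A : set 'rV[measurableTypeR R]_d) :
  measurable_fun A (word_monomial s).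
Proof.
by apply: measurable_prod => i _; apply: measurable_funTS; exact: measurable_coord.
Qed.

Lemma word_monomialE s x : word_monomial s x = \prod_i x ord0 i ^+ count_mem i s.
Proof.
elim: s => [|j s IH]; first by rewrite /word_monomial big_nil big1.
rewrite /word_monomial big_cons -/(word_monomial s x) IH.
rewrite (bigD1 j)//= [RHS](bigD1 j)//= eqxx exprS mulrA; congr (_ * _).
by apply: eq_bigr => i ij; rewrite eq_sym (negPf ij).
Qed.

Lemma dot_itv x y : unit_cube d x -> unit_cube d y ->
  0 <= \sum_i x ord0 i * y ord0 i <= d%:R.
Proof.
move=> xc yc; apply/andP; split.
  by apply: sumr_ge0 => i _; have /andP[? _] := xc i; have /andP[? _] := yc i; rewrite mulr_ge0.
rewrite -[leRHS](_ : \sum_(i < d) 1 = _); last by rewrite sumr_const card_ord.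
by apply: ler_sum => i _; have /andP[? ?] := xc i; have /andP[? ?] := yc i; rewrite mulr_ile1.
Qed.
End words.

Section gaussian.
Variables (R : realType) (d : nat) (sigma : R).
Hypothesis sigma0 : 0 < sigma.
Implicit Types x y z : 'rV[R]_d.

Definition gaussian_weight x := expR (- sigma * \sum_(i < d) x ord0 i ^+ 2).

Lemma gaussian_kernelE x y : gaussian_kernel sigma x y =
  gaussian_weight x * gaussian_weight y * expR (2 * sigma * \sum_i x ord0 i * y ord0 i).
Proof.
rewrite /gaussian_kernel /gaussian_weight -!expRD; congr expR.
rewrite !mulr_sumr -!big_split/=; apply: eq_bigr => i _; ring.
Qed.

Lemma gaussian_kernel_diag x : gaussian_kernel sigma x x = 1.
Proof.
rewrite /gaussian_kernel big1 ?mulr0 ?expR0// => i _; by rewrite subrr expr0n.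
Qed.

Lemma gaussian_weight_itv x : unit_cube d x ->
  expR (- sigma * d%:R) <= gaussian_weight x <= 1.
Proof.
move=> xc; have /andP[h0 h1] := dot_itv xc xc.
have E : \sum_(i < d) x ord0 i ^+ 2 = \sum_i x ord0 i * x ord0 i by [].
rewrite /gaussian_weight E; apply/andP; split.
  by rewrite ler_expR !mulNr lerN2 ler_pM2l.
by rewrite -[leRHS]expR0 ler_expR mulNr oppr_le0 mulr_ge0// ltW.
Qed.

Lemma measurable_gaussian_weight (A : set 'rV[measurableTypeR R]_d) :
  measurable_fun A gaussian_weight.
Proof.
apply: measurable_funTS; apply: measurableT_comp => //.
apply: measurable_funM => //; apply: measurable_sum => i.
by apply: measurable_funX; exact: measurable_coord.
Qed.

Definition word_coef (s : seq 'I_d) : R := (2 * sigma) ^+ size s / (size s)`!%:R.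

Definition word_function s x := gaussian_weight x * word_monomial s x.

Lemma word_expansionE x y M :
  \sum_(s <- words_below d M) word_coef s * word_function s x * word_function s y =
  gaussian_weight x * gaussian_weight y *
  \sum_(m < M) (2 * sigma * \sum_i x ord0 i * y ord0 i) ^+ m / m`!%:R.
Proof.
rewrite sum_words_below [RHS]mulr_sumr; apply: eq_bigr => m _.
rewrite exprMn exp_dot_words mulr_sumr mulr_suml mulr_sumr.
rewrite big_seq [RHS]big_seq; apply: eq_bigr => s /size_words sm.
rewrite /word_coef /word_function sm; ring.
Qed.

Lemma dot_exponent_itv x y : unit_cube d x -> unit_cube d y ->
  0 <= 2 * sigma * \sum_i x ord0 i * y ord0 i <= 2 * sigma * d%:R.
Proof.
move=> xc yc; have /andP[h0 h1] := dot_itv xc yc.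
have s0 : 0 < 2 * sigma by rewrite mulr_gt0.
by rewrite mulr_ge0 ?(ltW s0)// ler_pM2l.
Qed.

Lemma word_expansion_cvg x y :
  \sum_(s <- words_below d M) word_coef s * word_function s x * word_function s y
  @[M --> \oo] --> gaussian_kernel sigma x y.
Proof.
under eq_fun do rewrite word_expansionE.
by rewrite gaussian_kernelE; apply: cvgM; [exact: cvg_cst | exact: exp_partial_sum_cvg].
Qed.

Lemma gaussian_weight_mul_itv x y : unit_cube d x -> unit_cube d y ->
  0 <= gaussian_weight x * gaussian_weight y <= 1.
Proof.
move=> /gaussian_weight_itv/andP[_ x1] /gaussian_weight_itv/andP[_ y1].
by rewrite mulr_ge0 ?expR_ge0//= mulr_ile1 ?expR_ge0.
Qed.

Lemma word_expansion_bounded M x y : unit_cube d x -> unit_cube d y ->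
  `|\sum_(s <- words_below d M) word_coef s * word_function s x * word_function s y|
  <= expR (2 * sigma * d%:R).
Proof.
move=> xc yc; have /andP[t0 t1] := dot_exponent_itv xc yc.
have /andP[w0 w1] := gaussian_weight_mul_itv xc yc.
have s0 : 0 <= \sum_(m < M) (2 * sigma * \sum_i x ord0 i * y ord0 i) ^+ m / m`!%:R.
  by apply: sumr_ge0 => m _; rewrite divr_ge0// exprn_ge0.
rewrite word_expansionE ger0_norm ?mulr_ge0 ?expR_ge0//.
apply: (@le_trans _ _ (expR (2 * sigma * \sum_i x ord0 i * y ord0 i))).
  by rewrite -[leRHS]mul1r ler_pM// exp_partial_sum_le.
by rewrite ler_expR.
Qed.

Lemma word_expansion_error M x y : unit_cube d x -> unit_cube d y ->
  `|gaussian_kernel sigma x y -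
    \sum_(s <- words_below d M) word_coef s * word_function s x * word_function s y|
  <= (2 * sigma * d%:R) ^+ M / M`!%:R * expR (2 * sigma * d%:R).
Proof.
move=> xc yc; have /andP[t0 t1] := dot_exponent_itv xc yc.
have /andP[w0 w1] := gaussian_weight_mul_itv xc yc.
rewrite word_expansionE gaussian_kernelE -mulrBr normrM (ger0_norm w0).
rewrite -[leRHS]mul1r ler_pM//.
apply: le_trans (exp_tail_le M t0) _; rewrite ler_pM ?expR_ge0 ?ler_expR//.
  by rewrite divr_ge0// exprn_ge0.
by rewrite ler_wpM2r ?invr_ge0// lerXn2r// nnegrE (le_trans t0 t1).
Qed.

Lemma measurable_word_function s (A : set 'rV[measurableTypeR R]_d) :
  measurable_fun A (word_function s).
Proof.
apply: measurable_funM; first exact: measurable_gaussian_weight.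
exact: measurable_word_monomial.
Qed.

Lemma word_function_itv s x : unit_cube d x -> 0 <= word_function s x <= 1.
Proof.
move=> xc; have /andP[w0 w1] := gaussian_weight_itv xc.
have /andP[m0 m1] := word_monomial_itv s xc.
by rewrite mulr_ge0 ?expR_ge0//= mulr_ile1 ?expR_ge0.
Qed.

End gaussian.

(** * Tensor polynomials *)

Lemma exists_left_kernel (F : fieldType) (I : finType) L (M : I -> 'I_L -> F) :
  (L < #|I|)%N -> exists c : I -> F,
    (exists b, c b != 0) /\ forall i, \sum_b c b * M b i = 0.
Proof.
move=> LI; pose A := \matrix_(j < #|I|, i < L) M (enum_val j) i.
have : kermx A != 0.
  rewrite -mxrank_eq0 mxrank_ker subn_eq0 -ltnNge.
  exact: leq_ltn_trans (rank_leq_col A) LI.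
case/rowV0Pn => v /sub_kermxP vA v0; exists (fun b => v ord0 (enum_rank b)); split.
  have /existsP[j vj] : [exists j, v ord0 j != 0].
    apply: contraNT v0 => /existsPn h; apply/eqP/rowP => j; rewrite mxE.
    by have /negPn/eqP := h j.
  by exists (enum_val j); rewrite enum_valK.
move=> i; have /matrixP/(_ ord0 i) := vA; rewrite !mxE => vAi; rewrite -[RHS]vAi.
rewrite [RHS](reindex (@enum_rank I))/=; last exact/onW_bij/enum_rank_bij.
by apply: eq_bigr => b _; rewrite mxE enum_rankK.
Qed.

Section tensor_polynomials.
Variables (R : realType) (d n : nat).
Implicit Types (c : {ffun 'I_d -> 'I_n} -> R) (x : 'rV[R]_d).

Definition tensor_horner c x := \sum_b c b * \prod_k x ord0 k ^+ b k.

Lemma integrable_unit_cube_monomial (e : 'I_d -> nat) :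
  (lebesgue_rV d).-integrable (unit_cube d)
    (EFin \o (fun x : 'rV[R]_d => \prod_i x ord0 i ^+ e i)).
Proof.
apply/integrableP; split.
  apply/measurable_EFinP; apply: measurable_funTS.
  apply: (@measurable_prod_coord R d (fun i t => t ^+ e i)) => i.
  exact: measurable_funX.
rewrite (eq_integral (fun x : 'rV[R]_d => (\prod_i x ord0 i ^+ e i)%:E)).
  by rewrite integral_unit_cube_monomial ltry.
move=> x /[!inE] xc; rewrite /= ger0_norm//; apply: prodr_ge0 => i _.
by rewrite exprn_ge0//; have /andP[] := xc i.
Qed.

Lemma tensor_horner_sqr_integral c :
  (lebesgue_rV d).-integrable (unit_cube d) (EFin \o (fun x => tensor_horner c x ^+ 2)) /\
  \int[lebesgue_rV d]_(x in unit_cube d) (tensor_horner c x ^+ 2) = tensor_gram c c.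
Proof.
have E : (fun x => tensor_horner c x ^+ 2) = (fun x => \sum_b \sum_(g : {ffun 'I_d -> 'I_n})
    c b * c g * \prod_k x ord0 k ^+ (b k + g k)).
  apply/funext => x; rewrite /tensor_horner expr2 mulr_suml; apply: eq_bigr => b _.
  rewrite mulr_sumr; apply: eq_bigr => g _; rewrite mulrACA -big_split/=.
  by under eq_bigr do rewrite -exprD.
have mc := @measurable_unit_cube R d.
have i1 b (g : {ffun 'I_d -> 'I_n}) : (lebesgue_rV d).-integrable (unit_cube d)
    (EFin \o (fun x : 'rV[R]_d => c b * c g * \prod_k x ord0 k ^+ (b k + g k))).
  apply: integrable_EFinZl => //;
    exact: (integrable_unit_cube_monomial (fun k => (b k + g k)%N)).
have i2 b : (lebesgue_rV d).-integrable (unit_cube d) (EFin \o (fun x : 'rV[R]_d =>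
    \sum_(g : {ffun 'I_d -> 'I_n}) c b * c g * \prod_k x ord0 k ^+ (b k + g k))).
  by apply: integrable_EFin_sum.
rewrite E; split; first exact: integrable_EFin_sum.
rewrite Rintegral_sum//; apply: eq_bigr => b _; rewrite Rintegral_sum//; apply: eq_bigr => g _.
rewrite RintegralZl//; last exact: (integrable_unit_cube_monomial (fun k => (b k + g k)%N)).
by rewrite /Rintegral (@integral_unit_cube_monomial R d (fun k => (b k + g k)%N)).
Qed.

Lemma tensor_gram_ge0 c : 0 <= tensor_gram c c.
Proof.
rewrite -(tensor_horner_sqr_integral c).2; apply: Rintegral_ge0 => x _; exact: sqr_ge0.
Qed.

Lemma measurable_tensor_horner c (A : set 'rV[measurableTypeR R]_d) :
  measurable_fun A (tensor_horner c).
Proof.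
apply: measurable_funTS; apply: measurable_sum => b; apply: measurable_funM => //.
apply: (@measurable_prod_coord R d (fun i t => t ^+ b i)) => i.
exact: measurable_funX.
Qed.

Lemma tensor_horner_bounded c x : unit_cube d x -> `|tensor_horner c x| <= \sum_b `|c b|.
Proof.
move=> xc; rewrite (le_trans (ler_norm_sum _ _ _))//; apply: ler_sum => b _.
rewrite normrM ler_piMr// ger0_norm.
  apply: prodr_ile1 => i _; have /andP[x0 x1] := xc i.
  by rewrite exprn_ge0// exprn_ile1.
by apply: prodr_ge0 => i _; rewrite exprn_ge0//; have /andP[] := xc i.
Qed.

(** In a word of length less than [n] every letter occurs fewer than [n] times. Different words may
    have the same exponents, so the coefficients accumulate along the induction. *)
Lemma sum_words_tensor (r : seq (seq 'I_d)) (a : seq 'I_d -> R) :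
  (forall s, s \in r -> (size s < n)%N) ->
  exists c, forall x, \sum_(s <- r) a s * word_monomial s x = tensor_horner c x.
Proof.
elim: r => [|s r IH] h.
  by exists (fun=> 0) => x; rewrite big_nil /tensor_horner big1// => b _; rewrite mul0r.
have [|c cE] := IH; first by move=> t tr; apply: h; rewrite inE tr orbT.
have sn : (size s < n)%N by apply: h; rewrite inE eqxx.
have cn i : (count_mem i s < n)%N by rewrite (leq_ltn_trans (count_size _ _)).
pose b := [ffun i => Ordinal (cn i)].
exists (fun g => a s * (g == b)%:R + c g) => x.
rewrite big_cons cE /tensor_horner.
under [RHS]eq_bigr do rewrite mulrDl.
rewrite big_split/=; congr (_ + _).
rewrite [RHS](bigD1 b)//= eqxx mulr1 [X in _ = _ + X]big1 ?addr0 => [|g /negPf ->];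
  last by rewrite mulr0 mul0r.
by rewrite word_monomialE; congr (_ * _); apply: eq_bigr => i _; rewrite ffunE.
Qed.

(** Letter [i] is repeated [b i] times. The length bound matters later: it limits how small the
    Taylor coefficient [word_coef] of the word can be. *)
Lemma exponent_word (b : {ffun 'I_d -> 'I_n}) : exists s : seq 'I_d,
  (size s <= d * n)%N /\ forall x, word_monomial s x = \prod_k x ord0 k ^+ b k.
Proof.
exists (flatten [seq nseq (b i) i | i <- enum 'I_d]); split.
  rewrite size_flatten /shape -map_comp sumnE big_map big_enum/=.
  under eq_bigr do rewrite size_nseq.
  rewrite -[d in (d * n)%N]card_ord -sum_nat_const; apply: leq_sum => i _.
  exact: ltnW.
move=> x; rewrite /word_monomial big_flatten big_map big_enum/=.
apply: eq_bigr => i _; rewrite big_nseq; elim: (nat_of_ord (b i)) => //= m IH.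
by rewrite exprS -IH.
Qed.
End tensor_polynomials.

(** * Eigenvalues and eigenfunctions *)

Section mercer_eigenfunctions.
Variables (R : realType) (d : nat) (sigma : R).
Hypothesis sigma0 : 0 < sigma.
Variables (P : probability 'rV[R]_d R) (p : 'rV[R]_d -> R).
Hypothesis hP : has_cube_density P p.
Variable pmin : R.
Hypothesis pmin0 : 0 < pmin.
Hypothesis pmin_le : forall x, unit_cube d x -> pmin <= p x.
Variables (mu : nat -> R) (phi : nat -> 'rV[R]_d -> R).
Hypothesis hphi : mercer_decomposition (gaussian_kernel sigma) P p mu phi.

Let D : set 'rV[R]_d := unit_cube d.
Let mD : measurable D := @measurable_unit_cube R d.
Let k := @gaussian_kernel R d sigma.
Let wmin := expR (- sigma * d%:R).

Let density_ge0 x : D x -> 0 <= p x.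
Proof. by move=> /pmin_le; apply: le_trans; exact: ltW. Qed.

Lemma cube_probability1 : P D = 1%E.
Proof.
have := probability_setT P; rewrite !(hP.2 _)//.
by rewrite setTI setIid.
Qed.

Lemma Rintegral_cube_cst (c : R) : \int[P]_(x in D) c = c.
Proof.
transitivity (c * fine (P D)); first exact: Rintegral_cst.
by rewrite cube_probability1 mulr1.
Qed.

Lemma bounded_integrable_cube (f : 'rV[R]_d -> R) (C : R) : measurable_fun D f ->
  (forall x, D x -> `|f x| <= C) -> P.-integrable D (EFin \o f).
Proof.
move=> mf fC; apply: (le_integrable_EFin mD mf fC).
exact: finite_measure_integrable_cst.
Qed.

Lemma measurable_eigenfunction l : (1 <= l)%N -> measurable_fun D (phi l).
Proof. by move=> l1; apply: measurable_unit_cube_continuous;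
  exact: (mercer_continuous hphi). Qed.

(** The real integral of a function with infinite integral is 0 by convention, so the normalisation
    to 1 forces the integral of the square to be finite. *)
Lemma integrable_eigenfunction_sqr l : (1 <= l)%N ->
  P.-integrable D (EFin \o (fun x => phi l x ^+ 2)).
Proof.
move=> l1; have mphi := measurable_eigenfunction l1.
have mphi2 : measurable_fun D (fun x => phi l x ^+ 2) by exact: measurable_funX.
have := mercer_orthonormal hphi l1 l1; rewrite eqxx /Rintegral => h.
apply/integrableP; split; first exact/measurable_EFinP.
rewrite (eq_integral (fun x => (phi l x * phi l x)%:E)); last first.
  by move=> x _; rewrite /= ger0_norm ?sqr_ge0// expr2.
move: h; have : (0 <= \int[P]_(x in D) (phi l x * phi l x)%:E)%E.
  by apply: integral_ge0 => x _; rewrite lee_fin -expr2 sqr_ge0.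
rewrite -/D; case: (\int[P]_(x in D) _)%E => [r|/=|/=] //.
- by move=> _ _; rewrite ltry.
- by move=> _ /esym/eqP; rewrite oner_eq0.
Qed.

Lemma eigenfunction_sqr_integral l : (1 <= l)%N -> \int[P]_(x in D) (phi l x ^+ 2) = 1.
Proof. by move=> l1; have := mercer_orthonormal hphi l1 l1; rewrite eqxx. Qed.

Lemma integrable_eigenfunction l : (1 <= l)%N -> P.-integrable D (EFin \o phi l).
Proof.
move=> l1; apply: (@le_integrable_EFin _ _ _ P D mD _ (fun x => 1 + phi l x ^+ 2)).
- exact: measurable_eigenfunction.
- move=> x _; have := real_normK (num_real (phi l x)); have := sqr_ge0 (`|phi l x| - 1).
  have := normr_ge0 (phi l x); nra.
- apply: integrable_EFinD => //; last exact: integrable_eigenfunction_sqr.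
  exact: finite_measure_integrable_cst.
Qed.

(** From [|phi| <= (1 + phi^2) / 2] and total mass 1. *)
Lemma eigenfunction_norm_integral l : (1 <= l)%N -> \int[P]_(x in D) `|phi l x| <= 1.
Proof.
move=> l1; have i2 := integrable_eigenfunction_sqr l1.
have ic : P.-integrable D (EFin \o (fun=> 1 : R)) by exact: finite_measure_integrable_cst.
rewrite (_ : 1 = \int[P]_(x in D) (2^-1 * (1 + phi l x ^+ 2))); last first.
  rewrite RintegralZl//; last exact: integrable_EFinD.
  rewrite RintegralD// eigenfunction_sqr_integral// Rintegral_cube_cst; lra.
apply: le_Rintegral => //.
- by apply: integrable_norm; exact: integrable_eigenfunction.
- by apply: integrable_EFinZl => //; exact: integrable_EFinD.
- move=> x _; have := real_normK (num_real (phi l x)); have := sqr_ge0 (`|phi l x| - 1).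
  nra.
Qed.

Lemma eigenfunction_kernelE l y : (1 <= l)%N -> D y ->
  \int[P]_(z in D) (k z y * phi l z) = mu l * phi l y.
Proof.
move=> l1 Dy; rewrite -(mercer_eigen hphi l1 Dy) /integral_operator /Rintegral.
rewrite (@integral_density _ _ R (lebesgue_rV d) P D p)//.
- exact: hP.1.
- exact: hP.2.
- apply: measurable_funM; last exact: measurable_eigenfunction.
  (* Sections of the kernel are measurable as pointwise limits of the Taylor partial sums. *)
  apply: (@measurable_fun_cvg _ _ _ _ (fun M z => \sum_(s <- words_below d M)
     word_coef sigma s * word_function sigma s z * word_function sigma s y)).
  + move=> M; apply: measurable_sum => s; apply: measurable_funM => //.
    by apply: measurable_funM => //; exact: measurable_word_function.
  + by move=> z Dz; exact: word_expansion_cvg.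
Qed.

Lemma integrable_word_mul s (f : 'rV[R]_d -> R) : P.-integrable D (EFin \o f) ->
  P.-integrable D (EFin \o (fun z => word_function sigma s z * f z)).
Proof.
move=> intf; apply: (@le_integrable_EFin _ _ _ P D mD _ (fun z => `|f z|)).
- apply: measurable_funM; first exact: measurable_word_function.
  exact: integrable_EFin_measurable intf.
- move=> z Dz; have /andP[w0 w1] := word_function_itv sigma0 s Dz.
  by rewrite normrM (ger0_norm w0) ler_piMl.
- exact: integrable_norm.
Qed.

Let form (f : 'rV[R]_d -> R) := \int[P]_(y in D) (\int[P]_(z in D) (k z y * f z) * f y).

(** All Taylor coefficients are nonnegative, so each word alone bounds the form from below. *)
Lemma gaussian_form_ge s (f : 'rV[R]_d -> R) : P.-integrable D (EFin \o f) ->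
  word_coef sigma s * (\int[P]_(z in D) (word_function sigma s z * f z)) ^+ 2 <= form f.
Proof.
move=> intf; apply: (@kernel_expansion_form_ge _ _ R P D mD k (seq 'I_d) (word_coef sigma)
  (word_function sigma) (words_below d) (expR (2 * sigma * d%:R)) f) => //.
- by move=> t; exact: measurable_word_function.
- by move=> z y Dz Dy; exact: word_expansion_cvg.
- by move=> M z y Dz Dy; exact: word_expansion_bounded.
- by move=> t; exact: integrable_word_mul.
- by move=> t; rewrite divr_ge0// exprn_ge0// mulr_ge0// ltW.
- exists (size s).+1 => // M /= sM.
  have := mem_words_below sM => sr.
  by exists (take (index s (words_below d M)) (words_below d M)),
    (drop (index s (words_below d M)).+1 (words_below d M));
      rewrite -drop_index// cat_take_drop.
Qed.

(** The decomposition does not state positivity. It holds because [mu l] is the value of the form at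
    [phi l], which is bounded below by the nonnegative term of the empty word. *)
Lemma eigenvalue_ge0 l : (1 <= l)%N -> 0 <= mu l.
Proof.
move=> l1; have := gaussian_form_ge [::] (integrable_eigenfunction l1).
have -> : form (phi l) = mu l.
  rewrite -[RHS]mulr1 -(eigenfunction_sqr_integral l1) -RintegralZl//;
    last exact: integrable_eigenfunction_sqr.
  by apply: eq_Rintegral => y /[!inE] Dy; rewrite eigenfunction_kernelE// expr2 mulrA.
apply: le_trans; rewrite mulr_ge0 ?sqr_ge0//.
by rewrite divr_ge0// exprn_ge0// mulr_ge0// ltW.
Qed.

Lemma form_le_eigenvalue l (f : 'rV[R]_d -> R) : (1 <= l)%N -> measurable_fun D f ->
  P.-integrable D (EFin \o f) -> P.-integrable D (EFin \o (fun x => f x ^+ 2)) ->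
  (forall i, (1 <= i < l)%N -> \int[P]_(x in D) (phi i x * f x) = 0) ->
  form f <= mu l * \int[P]_(x in D) (f x ^+ 2).
Proof.
case: l => // l _ mf f1 f2 fphi.
(* Eigenpairs are renumbered from 0: the index [l.+1] left by the case analysis becomes [l]. *)
apply: (@spectral_form_le _ _ R P D mD (fun i => phi i.+1) f _ _ _ mf f1 f2 k
  (fun i => mu i.+1)).
- by move=> i; exact: measurable_eigenfunction.
- by move=> i; exact: integrable_eigenfunction_sqr.
- by move=> i j; rewrite (mercer_orthonormal hphi).
- by move=> i; exact: eigenvalue_ge0.
- by move=> i; exact: (mercer_nonincreasing hphi).
- move=> x y Dx Dy; have := mercer_expansion hphi Dx Dy.
  rewrite -cvg_shiftS/=; under eq_fun do rewrite big_add1 big_mkord.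
  by [].
- by move=> x _; rewrite /k gaussian_kernel_diag.
- by move=> i il; apply: fphi.
Qed.

Lemma tensor_gram_le n (c : {ffun 'I_d -> 'I_n} -> R) :
  pmin * wmin ^+ 2 * tensor_gram c c <=
  \int[P]_(x in D) ((gaussian_weight sigma x * tensor_horner c x) ^+ 2).
Proof.
have [iF <-] := tensor_horner_sqr_integral c.
have mF2 : measurable_fun D (fun x : 'rV[R]_d => tensor_horner c x ^+ 2).
  by apply: measurable_funX; exact: measurable_tensor_horner.
have F2_le x : D x -> tensor_horner c x ^+ 2 <= (\sum_b `|c b|) ^+ 2.
  move=> Dx; rewrite -real_normK ?num_real// lerXn2r ?nnegrE//.
    by apply: sumr_ge0.
  exact: tensor_horner_bounded.
have iP : P.-integrable D (EFin \o (fun x : 'rV[R]_d => tensor_horner c x ^+ 2)).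
  apply: (@bounded_integrable_cube _ ((\sum_b `|c b|) ^+ 2)) => // x Dx.
  by rewrite ger0_norm ?sqr_ge0// F2_le.
have h : pmin * \int[lebesgue_rV d]_(x in D) (tensor_horner c x ^+ 2) <=
    \int[P]_(x in D) (tensor_horner c x ^+ 2).
  have := @ge0_integral_density_ge _ _ R (lebesgue_rV d) P D p mD hP.1 density_ge0 hP.2 _ pmin
    mF2 (fun x _ => sqr_ge0 _) (ltW pmin0) pmin_le.
  rewrite -[X in (_ * X)%E]fineK; last exact: integrable_fin_num iF.
  rewrite -[X in (_ <= X)%E]fineK; last exact: integrable_fin_num iP.
  by rewrite -EFinM lee_fin.
have iw : P.-integrable D (EFin \o
    (fun x : 'rV[R]_d => (gaussian_weight sigma x * tensor_horner c x) ^+ 2)).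
  apply: (@bounded_integrable_cube _ ((\sum_b `|c b|) ^+ 2)).
    apply: measurable_funX; apply: measurable_funM; last exact: measurable_tensor_horner.
    exact: measurable_gaussian_weight.
  move=> x Dx; rewrite ger0_norm ?sqr_ge0// exprMn.
  have /andP[_ w1] := gaussian_weight_itv sigma0 Dx.
  by rewrite (le_trans _ (F2_le _ Dx))// ler_piMl ?sqr_ge0// exprn_ile1// expR_ge0.
rewrite [pmin * _]mulrC -mulrA; apply: (le_trans (ler_wpM2l (sqr_ge0 _) h)).
rewrite -RintegralZl//; apply: le_Rintegral => //; first exact: integrable_EFinZl.
move=> x Dx; have /andP[w1 _] := gaussian_weight_itv sigma0 Dx.
by rewrite exprMn ler_wpM2r ?sqr_ge0// lerXn2r// nnegrE expR_ge0.
Qed.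

(** Let [Ef] be the integral of [f^2], where [f] is the sum of the [c b * e b], and let
    [a = pmin * wmin^2], [B = ((2 n)^(2 n))^d]. Expanding one factor, [Ef] is the sum of the
    [c b * <e b, f>]. Here [(c b)^2 <= B Ef / a] by the coefficient bound, and
    [<e b, f>^2 <= W form f <= W mu_l Ef], because [W] bounds the inverse Taylor coefficients of the
    words of length at most [d * n]. So each of the [n^d] summands is at most
    [sqrt (B W mu_l / a) Ef], and [Ef > 0] cancels. *)
Lemma eigenvalue_lower_bound l n (W : R) : (1 <= l)%N -> (l <= n ^ d)%N ->
  (forall m, (m <= d * n)%N -> m`!%:R <= W * (2 * sigma) ^+ m) ->
  pmin * wmin ^+ 2 <=
  (n ^ d)%:R ^+ 2 * ((2 * n)%:R ^+ (2 * n)) ^+ d * W * mu l.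
Proof.
move=> l1 ln hW.
have L : (l.-1 < #|{ffun 'I_d -> 'I_n}|)%N by rewrite card_ffun !card_ord prednK.
pose e (b : {ffun 'I_d -> 'I_n}) (x : 'rV[R]_d) :=
  gaussian_weight sigma x * \prod_i x ord0 i ^+ b i.
have [c [[b0 cb0] c_perp]] := exists_left_kernel
  (fun b (i : 'I_l.-1) => \int[P]_(x in D) (e b x * phi i.+1 x)) L.
pose f x := gaussian_weight sigma x * tensor_horner c x.
have fE x : f x = \sum_b c b * e b x.
  by rewrite /f /tensor_horner mulr_sumr; apply: eq_bigr => b _; rewrite /e mulrCA.
have mf : measurable_fun D f.
  apply: measurable_funM; first exact: measurable_gaussian_weight.
  exact: measurable_tensor_horner.
have fC x : D x -> `|f x| <= \sum_b `|c b|.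
  move=> Dx; rewrite normrM (le_trans _ (tensor_horner_bounded c Dx))// ler_piMl//.
  by have /andP[_ w1] := gaussian_weight_itv sigma0 Dx; rewrite ger0_norm ?expR_ge0.
have f1 : P.-integrable D (EFin \o f) by exact: bounded_integrable_cube fC.
have f2 : P.-integrable D (EFin \o (fun x => f x ^+ 2)).
  apply: (@bounded_integrable_cube _ ((\sum_b `|c b|) ^+ 2)); first exact: measurable_funX.
  move=> x Dx; rewrite normrX lerXn2r ?nnegrE//; last exact: fC.
  by apply: sumr_ge0.
have eW b : exists s, (size s <= d * n)%N /\ forall x, word_function sigma s x = e b x.
  have [s [sn sE]] := exponent_word R b; exists s; split=> // x.
  by rewrite /word_function sE.
have ieg b (g : 'rV[R]_d -> R) : P.-integrable D (EFin \o g) ->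
    P.-integrable D (EFin \o (fun x => e b x * g x)).
  move=> ig; have [s [_ sE]] := eW b.
  rewrite (_ : (fun x => e b x * g x) = (fun x => word_function sigma s x * g x)).
    exact: integrable_word_mul.
  by apply/funext => x; rewrite sE.
pose Ef := \int[P]_(x in D) (f x ^+ 2).
have fg (g : 'rV[R]_d -> R) : P.-integrable D (EFin \o g) ->
    \int[P]_(x in D) (f x * g x) = \sum_b c b * \int[P]_(x in D) (e b x * g x).
  move=> ig; rewrite (_ : (fun x => f x * g x) = (fun x => \sum_b c b * (e b x * g x))).
    rewrite Rintegral_sum//; last by move=> b; apply: integrable_EFinZl => //; exact: ieg.
    by apply: eq_bigr => b _; rewrite RintegralZl//; exact: ieg.
  by apply/funext => x; rewrite fE mulr_suml; apply: eq_bigr => b _; rewrite [RHS]mulrA.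
have Q_le : form f <= mu l * Ef.
  apply: form_le_eigenvalue => // i /andP[i1 il].
  under eq_Rintegral do rewrite mulrC.
  rewrite fg; last exact: integrable_eigenfunction.
  have il' : (i.-1 < l.-1)%N by rewrite -ltnS !prednK.
  by have := c_perp (Ordinal il'); rewrite /= prednK.
have Ef_ge b : pmin * wmin ^+ 2 * c b ^+ 2 <= ((2 * n)%:R ^+ (2 * n)) ^+ d * Ef.
  have h := tensor_coef_le c b (@tensor_gram_ge0 R d n).
  have h2 := tensor_gram_le c.
  rewrite -/Ef in h2.
  apply: le_trans (ler_wpM2l _ h) _; first by rewrite mulr_ge0 ?sqr_ge0 ?ltW.
  by rewrite mulrCA ler_wpM2l// exprn_ge0// exprn_ge0.
have Ef0 : 0 < Ef.
  have h := Ef_ge b0.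
  have hp : 0 < pmin * wmin ^+ 2 * c b0 ^+ 2.
    by rewrite mulr_gt0 ?exprn_even_gt0// mulr_gt0 ?exprn_gt0 ?expR_gt0.
  have B0 : 0 <= ((2 * n)%:R ^+ (2 * n)) ^+ d :> R by rewrite exprn_ge0 ?exprn_ge0.
  rewrite lt_def Rintegral_ge0 => [|x _]; last exact: sqr_ge0.
  by rewrite andbT; apply/eqP => E0; move: h; rewrite E0 mulr0 leNgt hp.
have Sb b : (\int[P]_(x in D) (e b x * f x)) ^+ 2 <= W * (mu l * Ef).
  have [s [sn sE]] := eW b.
  have h : word_coef sigma s * (\int[P]_(x in D) (e b x * f x)) ^+ 2 <= form f.
    rewrite (_ : (fun x => e b x * f x) = (fun x => word_function sigma s x * f x)).
      exact: gaussian_form_ge.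
    by apply/funext => x; rewrite sE.
  have W0 : 0 <= W by have := hW 0%N (leq0n _); rewrite expr0 mulr1; apply: le_trans.
  have Wc : 1 <= W * word_coef sigma s.
    by rewrite mulrA ler_pdivlMr ?mul1r ?hW// ltr0n fact_gt0.
  apply: le_trans (ler_wpM2l W0 (le_trans h Q_le)).
  by rewrite mulrA ler_peMl ?sqr_ge0.
pose B : R := ((2 * n)%:R ^+ (2 * n)) ^+ d; pose a := pmin * wmin ^+ 2.
have a0 : 0 < a by rewrite mulr_gt0 ?exprn_gt0 ?expR_gt0.
have EfE : Ef = \sum_b c b * \int[P]_(x in D) (e b x * f x) by rewrite -fg.
pose X := B * W * mu l / a.
have X0b b : (c b * \int[P]_(x in D) (e b x * f x)) ^+ 2 <= X * Ef ^+ 2.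
  rewrite exprMn /X [leRHS]mulrAC ler_pdivlMr// mulrC mulrA.
  apply: le_trans (ler_pM _ (sqr_ge0 _) (Ef_ge b) (Sb b)) _.
    by rewrite mulr_ge0 ?sqr_ge0// ltW.
  by rewrite le_eqVlt; apply/orP; left; apply/eqP; rewrite /B; ring.
have X0 : 0 <= X.
  by have := le_trans (sqr_ge0 _) (X0b b0); rewrite pmulr_lge0// exprn_gt0.
have sX : Ef <= (n ^ d)%:R * (Num.sqrt X * Ef).
  rewrite {1}EfE; apply: (@le_trans _ _ (\sum_(b : {ffun 'I_d -> 'I_n}) Num.sqrt X * Ef)).
    apply: ler_sum => b _; apply: le_trans (ler_norm _) _.
    rewrite -(ler_pXn2r (ltn0Sn 1)) ?nnegrE ?mulr_ge0 ?sqrtr_ge0 ?(ltW Ef0)//.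
    by rewrite real_normK ?num_real// [leRHS]exprMn sqr_sqrtr.
  by rewrite sumr_const card_ffun !card_ord -[leLHS]mulr_natl.
rewrite mulrA -[leLHS]mul1r ler_pM2r// in sX.
have : 1 <= (n ^ d)%:R ^+ 2 * X.
  rewrite -[X in _ * X](sqr_sqrtr X0) -exprMn -[leLHS](expr1n _ 2).
  by rewrite lerXn2r ?nnegrE ?mulr_ge0 ?sqrtr_ge0.
rewrite /X mulrA ler_pdivlMr// mul1r => h; apply: le_trans h _; rewrite /B.
by rewrite le_eqVlt; apply/orP; left; apply/eqP; ring.
Qed.

(** An error of at most 1 is used twice: pointwise, for the summand 1, and in mean square, where the
    square of the approximant is at most [2 phi_l^2 + 2], with integral 4. *)
Lemma eigenfunction_sup_le l M : (1 <= l)%N -> 0 < mu l ->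
  (2 * sigma * d%:R) ^+ M / M`!%:R * expR (2 * sigma * d%:R) <= mu l ->
  forall x, D x ->
  `|phi l x| <= 1 + Num.sqrt ((2 * M%:R ^+ 2) ^+ d * (4 / (pmin * wmin ^+ 2))).
Proof.
move=> l1 mul0; set delta := (X in X <= _) => delta_le.
have ip := integrable_eigenfunction l1; have ip2 := integrable_eigenfunction_sqr l1.
pose S s := \int[P]_(z in D) (word_function sigma s z * phi l z).
have [c cE] := @sum_words_tensor R d M (words_below d M)
  (fun s => word_coef sigma s * S s / mu l) (@size_words_below d ^~ M).
have close y : D y -> `|phi l y - gaussian_weight sigma y * tensor_horner c y| <= 1.
  move=> Dy; rewrite -(ler_pM2l mul0) mulr1 -{1}(gtr0_norm mul0) -normrM.
  have K_int z : (\sum_(s <- words_below d M) word_coef sigma s * word_function sigma s z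
      * word_function sigma s y) * phi l z
     = \sum_(s <- words_below d M) (word_coef sigma s * word_function sigma s y) *
       (word_function sigma s z * phi l z).
    by rewrite mulr_suml; apply: eq_bigr => s _; ring.
  have iK : P.-integrable D (EFin \o (fun z => \sum_(s <- words_below d M)
      (word_coef sigma s * word_function sigma s y) * (word_function sigma s z * phi l z))).
    by apply: integrable_EFin_sum => // s; apply: integrable_EFinZl => //;
      exact: integrable_word_mul.
  have [ik _] := @kernel_expansion_section_cvg _ _ R P D mD k (seq 'I_d) (word_coef sigma)
    (word_function sigma) (words_below d) (expR (2 * sigma * d%:R)) (phi l)
    (fun z y Dz Dy => @word_expansion_cvg R d sigma z y)
    (fun M z y Dz Dy => word_expansion_bounded sigma0 M Dz Dy) ip
    (fun s => integrable_word_mul s ip) y Dy.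
  have -> : mu l * (phi l y - gaussian_weight sigma y * tensor_horner c y) =
      \int[P]_(z in D) (k z y * phi l z - \sum_(s <- words_below d M) (word_coef sigma s *
        word_function sigma s y) * (word_function sigma s z * phi l z)).
    rewrite RintegralB// eigenfunction_kernelE// mulrBr; congr (_ - _).
    rewrite Rintegral_sum//; last by move=> s; apply: integrable_EFinZl => //;
      exact: integrable_word_mul.
    rewrite -cE !mulr_sumr; apply: eq_bigr => s _.
    rewrite RintegralZl//; last exact: integrable_word_mul.
    by rewrite -/(S s) /word_function; field; rewrite gt_eqF.
  apply: le_trans (le_normr_Rintegral _ _) _ => //.
    apply: eq_integrable (integrableB mD ik iK) => // z _.
  apply: (@le_trans _ _ (\int[P]_(z in D) (delta * `|phi l z|))).
    apply: le_Rintegral => //.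
    - apply: integrable_norm; apply: eq_integrable (integrableB mD ik iK) => // z _.
    - by apply: integrable_EFinZl => //; exact: integrable_norm.
    - move=> z Dz; rewrite -K_int -mulrBl normrM ler_wpM2r//.
      exact: word_expansion_error.
  rewrite RintegralZl//; last exact: integrable_norm.
  have d0 : 0 <= delta.
    by rewrite mulr_ge0 ?expR_ge0// divr_ge0// exprn_ge0// !mulr_ge0// ltW.
  by rewrite (le_trans _ delta_le)// ler_piMr// eigenfunction_norm_integral.
have ic : P.-integrable D (EFin \o (fun=> 2 : R)) by exact: finite_measure_integrable_cst.
have L2 : \int[P]_(x in D) ((gaussian_weight sigma x * tensor_horner c x) ^+ 2) <= 4.
  have -> : 4 = \int[P]_(x in D) (2 * phi l x ^+ 2 + 2).
    rewrite RintegralD//; last exact: integrable_EFinZl.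
    by rewrite RintegralZl// eigenfunction_sqr_integral// Rintegral_cube_cst; lra.
  have ib : P.-integrable D (EFin \o (fun x => 2 * phi l x ^+ 2 + 2)).
    by apply: integrable_EFinD => //; exact: integrable_EFinZl.
  have le2 x : D x -> (gaussian_weight sigma x * tensor_horner c x) ^+ 2 <= 2 * phi l x ^+
    2 + 2.
    move=> Dx; have := close x Dx; rewrite ler_norml => /andP[h1 h2].
    (* [2 phi^2 + 2 (phi - u)^2 - u^2 = (2 phi - u)^2], and [(phi - u)^2 <= 1]. *)
    set u := _ * _ in h1 h2 *; have := sqr_ge0 (2 * phi l x - u).
    nra.
  apply: le_Rintegral => //.
  apply: le_integrable_EFin ib => //.
    apply: measurable_funX; apply: measurable_funM; last exact: measurable_tensor_horner.
    exact: measurable_gaussian_weight.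
  by move=> x Dx; rewrite ger0_norm ?sqr_ge0// le2.
move=> x Dx; have a0 : 0 < pmin * wmin ^+ 2 by rewrite mulr_gt0 ?exprn_gt0 ?expR_gt0.
have qx : `|tensor_horner c x| <= Num.sqrt ((2 * M%:R ^+ 2) ^+ d * (4 / (pmin * wmin ^+ 2))).
  rewrite -sqrtr_sqr ler_wsqrtr//.
  apply: le_trans (@tensor_horner_le R d M c (fun i => x ord0 i) (@tensor_gram_ge0 R d M) Dx) _.
  rewrite ler_wpM2l ?exprn_ge0 ?mulr_ge0 ?sqr_ge0//.
  by rewrite ler_pdivlMr// mulrC (le_trans (tensor_gram_le c)).
have /andP[w0 w1] := gaussian_weight_itv sigma0 Dx.
rewrite -[phi l x](subrK (gaussian_weight sigma x * tensor_horner c x)).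
rewrite (le_trans (ler_normD _ _))// lerD ?close// (le_trans _ qx)// normrM.
by rewrite ler_piMl// ger0_norm ?expR_ge0.
Qed.

End mercer_eigenfunctions.

(** * Superexponential growth of the factorial *)

Lemma leq_expn_fact n j : (n ^ j <= (n + j)`!)%N.
Proof.
elim: j => [|j IH]; first by rewrite fact_gt0.
rewrite addnS factS expnS leq_mul//; lia.
Qed.

Lemma fact_leq_expn n : (n`! <= n ^ n)%N.
Proof.
elim: n => // n IH; rewrite factS expnS leq_mul// (leq_trans IH)//.
by case: n {IH} => // n; rewrite leq_exp2r.
Qed.

(** Everything is compared with powers of [n]: [K^2 <= n] gives [K^(2 n^2) <= n^(n^2)], and
    [2 n <= n^2], [d n <= n^2], [K <= n] bound the other factors by [n^(1 + 2 d + 7 d n)]. As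
    [n >= 9 d + 2], the total exponent is at most [2 n^2 - n], and [leq_expn_fact] applies. *)
Lemma superexponential_fact d K n : (1 <= d)%N -> (2 <= K)%N -> (d <= K)%N ->
  (K ^ 2 <= n)%N -> (9 * d + 2 <= n)%N ->
  (K ^ (2 * n ^ 2) * K * ((n ^ d) ^ 2 * ((2 * n) ^ (2 * n)) ^ d * ((d * n)`! * K ^ (d * n)))
   <= (2 * n ^ 2)`!)%N.
Proof.
move=> d1 K2 dK Kn dn.
have n0 : (0 < n)%N by lia.
have K_n : (K <= n)%N by rewrite (leq_trans _ Kn)// -{1}(expn1 K) leq_exp2l.
apply: leq_trans (_ : n ^ (n ^ 2 + 1 + (2 * d + 4 * d * n + (2 * d * n + d * n))) <= _)%N;
  last first.
  rewrite -[X in (_ <= X`!)%N](@subnKC n); last by nia.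
  apply: leq_trans (leq_expn_fact _ _); rewrite leq_pexp2l//; nia.
rewrite (expnD n (n ^ 2 + 1)) (expnD n (n ^ 2) 1) (expnD n (2 * d + 4 * d * n))
  (expnD n (2 * d)) (expnD n (2 * d * n)) expn1.
apply: leq_mul.
  by apply: leq_mul => //; rewrite (expnM K 2) leq_exp2r// expn_gt0 n0.
apply: leq_mul; last apply: leq_mul; first apply: leq_mul.
- by rewrite -expnM mulnC.
- rewrite -expnM; apply: leq_trans (_ : (n ^ 2) ^ (2 * n * d) <= _)%N.
    by rewrite leq_exp2r; nia.
  by rewrite -expnM leq_pexp2l//; nia.
- apply: leq_trans (fact_leq_expn _) _; apply: leq_trans (_ : (n ^ 2) ^ (d * n) <= _)%N.
    by rewrite leq_exp2r; nia.
  by rewrite -expnM leq_pexp2l//; nia.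
- by rewrite leq_exp2r//; nia.
Qed.

(** For the least [m] with [l <= m^d], either [m = 1], or [(m - 1)^d < l] and [m <= 2 (m - 1)]. *)
Lemma root_ceil d l : (1 <= d)%N -> (1 <= l)%N ->
  exists m, [/\ (1 <= m)%N, (l <= m ^ d)%N & (m ^ d <= 2 ^ d * l)%N].
Proof.
move=> d1 l1; have ex : exists m, (l <= m ^ d)%N.
  by exists l; rewrite -{1}(expn1 l) leq_pexp2l.
case: (ex_minnP ex) => m lm m_min.
have m1 : (1 <= m)%N.
  by case: m lm {m_min} => //; rewrite exp0n// leqNgt l1.
exists m; split=> //; case: m m1 lm m_min => // -[|m] _ lm m_min.
  by rewrite exp1n muln_gt0 expn_gt0 l1.
have lt : (m.+1 ^ d < l)%N.
  by rewrite ltnNge; apply/negP => /m_min; rewrite ltnn.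
apply: leq_trans (_ : (2 * m.+1) ^ d <= _)%N; first by rewrite leq_exp2r//; lia.
by rewrite expnMn leq_mul// ltnW.
Qed.

(** * Choice of the constants and conclusion *)

Unset Implicit Arguments.

Theorem mainTheorem7 (R : realType) (d : nat) (hd : (1 <= d)%N)
    (sigma : R) (hsigma : 0 < sigma)
    (P : probability 'rV[R]_d R) (p : 'rV[R]_d -> R)
    (hP : has_cube_density P p)
    (hinf : (0 < ereal_inf [set (p x)%:E | x in unit_cube d])%E)
    (hsup : (ereal_sup [set (p x)%:E | x in unit_cube d] < +oo)%E)
    (mu : nat -> R) (phi : nat -> 'rV[R]_d -> R)
    (hphi : mercer_decomposition (gaussian_kernel sigma) P p mu phi) :
  exists2 b : R, 0 < b &
    forall l : nat, (1 <= l)%N ->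
      forall x, unit_cube d x -> `|phi l x| <= b * l%:R ^+ 2.
Proof.
have [pmin pmin0 pmin_le] : exists2 c : R, 0 < c & forall x, unit_cube d x -> c <= p x.
  have lb x : unit_cube d x -> (ereal_inf [set (p x)%:E | x in unit_cube d] <= (p x)%:E)%E.
    by move=> xc; apply: ereal_inf_lbound; exists x.
  (* A point of the cube is needed to exclude an infimum equal to [+oo]. *)
  have c0 : unit_cube d (0 : 'rV[R]_d) by move=> i; rewrite mxE lexx ler01.
  move: hinf lb; case: (ereal_inf _) => [r| |] // r0 lb.
    by exists r => [|x /lb]; rewrite -?lte_fin -?lee_fin.
  by have := lb _ c0; rewrite leye_eq.
pose a := pmin * expR (- sigma * d%:R) ^+ 2.
have a0 : 0 < a by rewrite mulr_gt0 ?exprn_gt0 ?expR_gt0.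
pose t := 2 * sigma * d%:R; have t0 : 0 <= t by rewrite !mulr_ge0 // ltW.
have s0 : 0 < 2 * sigma by rewrite mulr_gt0.
have le_natr (u : R) j : 0 <= u -> (Num.truncn u < j)%N -> u <= j%:R.
  move=> u0 uj; have /andP[_ /ltW h] := truncn_itv u0.
  by rewrite (le_trans h) // ler_nat.
(* One integer dominates all real constants, so that the final comparison takes place between
   natural numbers: [t] for the truncation error, [1 / (2 sigma)] for the inverse Taylor
   coefficients, [expR t / a] for the remaining factors. *)
have [K [K2 dK [tK sK eK]]] : exists K, [/\ (2 <= K)%N, (d <= K)%N &
    [/\ t <= K%:R, (2 * sigma)^-1 <= K%:R & expR t / a <= K%:R]].
  exists (2 + d + Num.truncn t + Num.truncn (2 * sigma)^-1 + Num.truncn (expR t / a))%N.+1.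
  move: (Num.truncn t) (Num.truncn (2 * sigma)^-1) (Num.truncn (expR t / a))
    (le_natr t) (le_natr (2 * sigma)^-1) (le_natr (expR t / a)) => u v w hu hv hw.
  split; [lia | lia | split].
  - by apply: hu => //; lia.
  - by apply: hv; [rewrite invr_ge0 ltW | lia].
  - by apply: hw; [rewrite divr_ge0 ?expR_ge0 // ltW | lia].
have [n0 [Kn0 dn0]] : exists n0, (K ^ 2 <= n0)%N /\ (9 * d + 2 <= n0)%N.
  by exists (K ^ 2 + (9 * d + 2))%N; rewrite leq_addr leq_addl.
have n0_gt0 : (0 < n0)%N by rewrite (leq_trans _ dn0) // addn_gt0 orbT.
(* With [M = 2 (n0 m)^2] one has [(2 M^2)^d = 8^d n0^(4 d) (m^d)^4], and [m^d <= 2^d l] gives the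
   factor [2^(4 d) l^4]; the square root then yields [l^2]. *)
pose A : R := 8 ^+ d * n0%:R ^+ (4 * d) * 2 ^+ (4 * d) * (4 / a).
exists (1 + Num.sqrt A) => [|l l1 x xc]; first by rewrite ltr_pwDl ?sqrtr_ge0.
have [m [m1 lm ml]] := root_ceil hd l1.
(* The factor [n0] makes [n] large enough for every [l >= 1], so no small values of [l] remain to be
   treated apart. *)
have [n nE] : exists n, n = (n0 * m)%N by exists (n0 * m)%N.
have [M ME] : exists M, M = (2 * n ^ 2)%N by exists (2 * n ^ 2)%N.
have n0n : (n0 <= n)%N by rewrite nE leq_pmulr.
have n_gt0 : (0 < n)%N by exact: leq_trans n0n.
have ln : (l <= n ^ d)%N by rewrite (leq_trans lm) // leq_exp2r // nE leq_pmull.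
pose W : R := (d * n)`!%:R * K%:R ^+ (d * n).
have Ks : 1 <= K%:R * (2 * sigma) by rewrite -ler_pdivrMr // div1r.
(* For [j <= d n], [j! <= (d n)!], and [K^(d n) (2 sigma)^j >= 1] because both [K] and [2 sigma K]
   are at least 1. *)
have hW j : (j <= d * n)%N -> j`!%:R <= W * (2 * sigma) ^+ j.
  move=> jn; rewrite /W -mulrA -[leLHS]mulr1; apply: ler_pM => //.
    by rewrite ler_nat; exact: leq_fact.
  rewrite -(subnK jn) exprD -mulrA -exprMn.
  by rewrite -[leLHS]mulr1 ler_pM // exprn_ege1 // ler1n ltnW.
have := eigenvalue_lower_bound hsigma hP pmin0 pmin_le hphi l1 ln hW; rewrite -/a.
set Xn := (X in X * mu l) => lower.
have XnE : Xn = ((n ^ d) ^ 2 * ((2 * n) ^ (2 * n)) ^ d * ((d * n)`! * K ^ (d * n)))%N%:R.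
  by rewrite /Xn /W -!natrX -!natrM.
have Xn0 : 0 < Xn.
  by rewrite XnE ltr0n !muln_gt0 !expn_gt0 fact_gt0 !muln_gt0 n_gt0 (ltnW K2).
clearbody Xn.
have mul0 : 0 < mu l by rewrite -(pmulr_rgt0 _ Xn0); exact: lt_le_trans lower.
have delta_le : t ^+ M / M`!%:R * expR t <= mu l.
  rewrite -(ler_pM2l Xn0); apply: le_trans lower.
  have e0 : expR t <= K%:R * a by rewrite -ler_pdivrMr.
  have h := superexponential_fact hd K2 dK (leq_trans Kn0 n0n) (leq_trans dn0 n0n).
  rewrite -ME -(ler_nat R) in h.
  rewrite mulrC [_ / _ * expR t]mulrAC [_ / _ * Xn]mulrAC.
  rewrite ler_pdivrMr ?ltr0n ?fact_gt0 //.
  apply: (@le_trans _ _ (K%:R ^+ M * (K%:R * a) * Xn)).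
    by rewrite ler_wpM2r ?(ltW Xn0) // ler_pM ?exprn_ge0 ?expR_ge0 // lerXn2r // nnegrE.
  have -> : K%:R ^+ M * (K%:R * a) * Xn = a * (K%:R ^+ M * K%:R * Xn) by ring.
  by rewrite ler_pM2l // XnE -natrX -!natrM.
apply: le_trans (eigenfunction_sup_le hsigma hP pmin0 pmin_le hphi l1 mul0 delta_le xc) _.
rewrite -/a [leRHS]mulrDl mul1r; apply: lerD.
  by rewrite -natrX ler1n expn_gt0 l1.
have A0 : 0 <= A by rewrite !mulr_ge0 ?exprn_ge0 // invr_ge0 ltW.
have l20 : (0 : R) <= l%:R ^+ 2 by rewrite exprn_ge0.
rewrite -[in leRHS](ger0_norm l20) -sqrtr_sqr -sqrtrM //; apply: ler_wsqrtr.
have -> : (2 * M%:R ^+ 2) ^+ d * (4 / a) =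
    8 ^+ d * n0%:R ^+ (4 * d) * (4 / a) * (m ^ d)%:R ^+ 4 :> R.
  have -> : (m ^ d)%:R ^+ 4 = m%:R ^+ (4 * d) :> R by rewrite natrX -exprM mulnC.
  rewrite mulrAC; congr (_ * _).
  rewrite (exprM n0%:R) (exprM m%:R) -!exprMn; congr (_ ^+ _).
  by rewrite ME nE natrM natrX natrM; ring.
have -> : A * (l%:R ^+ 2) ^+ 2 =
    8 ^+ d * n0%:R ^+ (4 * d) * (4 / a) * (2 ^ d * l)%:R ^+ 4.
  by rewrite natrM natrX [in RHS]exprMn -[in RHS]exprM [(d * 4)%N]mulnC /A; ring.
rewrite ler_wpM2l ?mulr_ge0 ?exprn_ge0 ?invr_ge0 ?(ltW a0) //.
by rewrite lerXn2r ?nnegrE // ler_nat.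
Qed.
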